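(* Let $\alpha,\beta\in(0,1)$, $a,b\in H_0^1(\Omega)$, and $f,g\in L^2(\Omega)$. Fix $T>0$. Assume that $\mu,\nu\in L^\infty(0,T)$ admit representatives such that $$\mu(t)=\mu_0+O(t),\qquad \nu(t)=\nu_0+O(t)\qquad(t\downarrow0),$$ where $\mu_0,\nu_0\in\mathbb R$. Let $\psi\in\mathcal D(A^2)\cap\mathcal D(B^2)$ and suppose that $$c_A:=\mu_0(f,\psi)-(a,A\psi)\neq0,\qquad c_B:=\nu_0(g,\psi)-(b,B\psi)\neq0.$$ Let $u$ be the solution of $$\partial_t^\alpha(u-a)+Au=\mu(t)f(x)\ \text{ in }\Omega\times(0,T),\qquad u=0\ \text{ on }\partial\Omega\times(0,T),\qquad u-a\in H_\alpha(0,T;L^2(\Omega)),$$ and let $v$ be the solution of $$\partial_t^\beta(v-b)+Bv=\nu(t)g(x)\ \text{ in }\Omega\times(0,T),\qquad v=0\ \text{ on }\partial\Omega\times(0,T),\qquad v-b\in H_\beta(0,T;L^2(\Omega)).$$ If $$\int_\Omega u(x,t)\psi(x)\,dx=\int_\Omega v(x,t)\psi(x)\,dx\qquad\text{for all }0<t<T,$$ then $$\alpha=\beta,\qquad (a,\psi)=(b,\psi),\qquad c_A=c_B.$$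
   Context: $\Omega\subset\mathbb R^N$, $N\ge1$, is a bounded connected domain with smooth boundary $\partial\Omega$. All coefficients and data are real-valued; $(\cdot,\cdot)$ is the scalar product of $L^2(\Omega)$. Elliptic operators: $Aw=-\sum_{i,j=1}^N\partial_i(a_{ij}(x)\partial_jw)-c(x)w$ and $Bw=-\sum_{i,j=1}^N\partial_i(b_{ij}(x)\partial_jw)-d(x)w$, both with domain $\mathcal D(A)=\mathcal D(B)=H^2(\Omega)\cap H^1_0(\Omega)$, where $a_{ij}=a_{ji}$, $b_{ij}=b_{ji}$, $c$, $d$ are in $C^1(\overline\Omega)$, $c\le0$, $d\le0$, and for some $\kappa_A,\kappa_B>0$, $\sum_{i,j}a_{ij}(x)\zeta_i\zeta_j\ge\kappa_A|\zeta|^2$ and $\sum_{i,j}b_{ij}(x)\zeta_i\zeta_j\ge\kappa_B|\zeta|^2$ for all $x\in\overline\Omega$, $\zeta\in\mathbb R^N$. Then $A$ and $B$ are positive self-adjoint operators in $L^2(\Omega)$ with compact inverses. $\mathcal D(A^2)=\{w\in\mathcal D(A):Aw\in\mathcal D(A)\}$ and $\mathcal D(B^2)=\{w\in\mathcal D(B):Bw\in\mathcal D(B)\}$; thus $\psi\in\mathcal D(A^2)\cap\mathcal D(B^2)$ means that $\psi$, $A\psi$, $B\psi$ all belong to $H^2(\Omega)\cap H_0^1(\Omega)$. Fractional derivative: for $0<\gamma<1$ and $w\in L^2(0,T;L^2(\Omega))$ put $J^\gamma w(t)=\frac1{\Gamma(\gamma)}\int_0^t(t-s)^{\gamma-1}w(s)\,ds$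 (Bochner integral). Set $H_\gamma(0,T;L^2(\Omega))=J^\gamma L^2(0,T;L^2(\Omega))$ and $\partial_t^\gamma=(J^\gamma)^{-1}$ with domain $H_\gamma(0,T;L^2(\Omega))$. Notion of solution: $u$ belongs to $L^2(0,T;H^2(\Omega)\cap H_0^1(\Omega))$ with $u-a\in H_\alpha(0,T;L^2(\Omega))$, and the equation holds in $L^2(0,T;L^2(\Omega))$; similarly for $v$. It is known that, for initial values in $H_0^1(\Omega)$, spatial factors in $L^2(\Omega)$ and temporal factors in $L^\infty(0,T)$, there is exactly one such solution, and that it has a representative continuous from $[0,T]$ to $L^2(\Omega)$ taking the prescribed initial value at $t=0$; this representative is used in the pointwise-in-time observation. *)

(* Defs.v *)
From HB Require Import structures.
From mathcomp Require Import all_boot all_order all_algebra.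
From mathcomp Require Import all_classical all_reals all_analysis.

Set Implicit Arguments.
Unset Strict Implicit.
Unset Printing Implicit Defensive.

Import Order.TTheory GRing.Theory Num.Theory.
Import numFieldNormedType.Exports.

Local Open Scope classical_set_scope.
Local Open Scope ring_scope.

Section lebesgue_outer_measure.
Context {R : realType} (n : nat).
Local Notation V := 'rV[R]_n.+1.
Local Open Scope ereal_scope.

Definition obox (p : V * V) : set V :=
  [set x | forall i, (p.1 ord0 i < x ord0 i <= p.2 ord0 i)%R].

(* The maximum makes the volume of the empty box 0 when p.2 i < p.1 i. *)
Definition obox_vol (p : V * V) : \bar R :=
  (\prod_(i < n.+1) Num.max 0 (p.2 ord0 i - p.1 ord0 i))%:E.

Definition obox_cover (A : set V) : set (nat -> V * V) :=
  [set C | A `<=` \bigcup_k obox (C k)].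

Definition lebesgue_outer (A : set V) : \bar R :=
  ereal_inf [set \sum_(k <oo) obox_vol (C k) | C in obox_cover A].

Lemma obox_vol_ge0 p : 0 <= obox_vol p.
Proof. by rewrite lee_fin; apply: prodr_ge0 => i _; rewrite le_max lexx. Qed.

Lemma le_lebesgue_outer :
  {homo lebesgue_outer : A B / A `<=` B >-> A <= B}.
Proof.
move=> A B AB; apply/ereal_inf_le_tmp => x [C BC <-].
by exists C => //; exact: subset_trans AB BC.
Qed.

Lemma lebesgue_outer_ge0 A : 0 <= lebesgue_outer A.
Proof.
apply: le_ereal_inf_tmp => x [C _ <-].
by apply: nneseries_ge0 => k _ _; exact: obox_vol_ge0.
Qed.

Lemma lebesgue_outer0 : lebesgue_outer set0 = 0.
Proof.
apply/eqP; rewrite eq_le lebesgue_outer_ge0 andbT.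
apply: ereal_inf_lbound; exists (fun=> (0%R, 0%R)); first exact: sub0set.
rewrite eseries0// => k _ _.
by rewrite /obox_vol/= big_ord_recl/= mxE subrr maxxx mul0r.
Qed.

Lemma lebesgue_outer_sigma_subadditive : sigma_subadditive lebesgue_outer.
Proof.
move=> A; have [[i ioo]|] := pselect (exists i, lebesgue_outer (A i) = +oo).
  rewrite (eseries_pinfty _ _ ioo) ?leey// => k _.
  by rewrite -ltNye (lt_le_trans _ (lebesgue_outer_ge0 _)).
rewrite -forallNE => Aoo.
suff add2e (e : {posnum R}) : lebesgue_outer (\bigcup_k A k) <=
    \sum_(i <oo) lebesgue_outer (A i) + e%:num%:E.
  by apply/lee_addgt0Pr => _/posnumP[].
rewrite (le_trans _ (epsilon_trick _ _ _))//; last first.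
  by move=> k; exact: lebesgue_outer_ge0.
pose P k (C : nat -> V * V) := obox_cover (A k) C /\
  \sum_(j <oo) obox_vol (C j) <=
    lebesgue_outer (A k) + (e%:num / (2 ^ k.+1)%:R)%:E.
have [G PG] : {G : nat -> nat -> V * V & forall k, P k (G k)}.
  apply: (@choice _ _ P) => k; rewrite /P /lebesgue_outer.
  set S := (X in ereal_inf X); move infS : (ereal_inf S) => iS.
  case: iS infS => [r Sr|Soo|Soo].
  - have en1 : (0 < e%:num / (2 ^ k.+1)%:R)%R by [].
    have /(lb_ereal_inf_adherent en1) : ereal_inf S \is a fin_num by rewrite Sr.
    move=> [x [C AC volC] xS].
    by exists C; split => //; rewrite volC -Sr; exact/ltW.
  - by have := Aoo k; rewrite /lebesgue_outer Soo.
  - by have := lebesgue_outer_ge0 (A k); rewrite /lebesgue_outer Soo.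
have volG_ge0 x : 0 <= (obox_vol \o uncurry G) x by exact: obox_vol_ge0.
apply: (@le_trans _ _ (\esum_(i in setT) (obox_vol \o uncurry G) i)).
  apply: ereal_inf_lbound => /=.
  have /card_esym/ppcard_eqP[f] := card_nat2.
  exists (uncurry G \o f).
    move=> t [i _ /(PG i).1 [j _ Gijt]].
    by exists (f^-1%FUN (i, j)) => //=; rewrite invK ?inE.
  rewrite -(esum_pred_image (obox_vol \o uncurry G) _ xpredT) ?[fun=> _]set_true//.
  by rewrite image_eq.
rewrite (_ : esum _ _ = \sum_(i <oo) \sum_(j <oo) obox_vol (G i j)); last first.
  pose J : nat -> set (nat * nat) := fun i => [set (i, j) | j in setT].
  rewrite (_ : setT = \bigcup_k J k); last first.
    by rewrite predeqE => -[a b]; split => // _; exists a => //; exists b.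
  rewrite esum_bigcupT /=; last 2 first.
    - apply/trivIsetP => i j _ _ ij.
      rewrite predeqE => -[k m] /=; split => //= -[] [_] _ [<-{k} _].
      by move=> [m' _] [] /esym/eqP; rewrite (negbTE ij).
    - by move=> /= [k m]; exact: obox_vol_ge0.
  rewrite -(image_id [set: nat]) -fun_true esum_pred_image//; last first.
    by move=> k _; apply: esum_ge0 => p _; exact: obox_vol_ge0.
  apply: eq_eseriesr => /= j _.
  rewrite -(esum_pred_image (obox_vol \o uncurry G) (pair j) predT)//=; last 2 first.
    - by move=> ? _; exact: obox_vol_ge0.
    - by move=> ? ? _ _; exact: (@can_inj _ _ _ snd).
  by congr esum; rewrite predeqE => -[a b]; split; move=> [i _ <-]; exists i.
apply: lee_lim.
- apply: is_cvg_nneseries => k *.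
  by apply: nneseries_ge0 => m *; exact: (volG_ge0 (k, m)).
- apply: is_cvg_nneseries => k *; apply: adde_ge0 => //.
  exact: lebesgue_outer_ge0.
- by near=> k; apply: lee_sum => i _; exact: (PG i).2.
Unshelve. all: by end_near. Qed.

HB.instance Definition _ := isOuterMeasure.Build R V lebesgue_outer
  lebesgue_outer0 lebesgue_outer_ge0 le_lebesgue_outer
  lebesgue_outer_sigma_subadditive.

End lebesgue_outer_measure.
Arguments lebesgue_outer : clear implicits.

Definition lebesgue_outer_measure (R : realType) (n : nat) :
  {outer_measure set 'rV[R]_n.+1 -> \bar R} := lebesgue_outer R n.

(* R^N with the sigma-algebra of its Lebesgue-measurable sets. *)
Notation Rn R n := (caratheodory_type (lebesgue_outer_measure R n)).

Definition lebesgueN (R : realType) (n : nat) :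
    {measure set (Rn R n) -> \bar R} :=
  (lebesgue_outer_measure R n : set (Rn R n) -> \bar R).

Record simple_vfun (R : realType) (X : Type) := SimpleVFun {
  sv_size : nat ;
  sv_set : 'I_sv_size -> set R ;
  sv_val : 'I_sv_size -> X -> R }.
Arguments sv_set {R X} s k : rename.
Arguments sv_val {R X} s k x : rename.

(* A normed space of classes of functions on X is presented by the set V of
   representatives of its elements and by its norm nrm, a seminorm on V.
   Integrals over t of nrm (w t) are taken for strongly measurable w only:
   the integrand is then a.e. equal to a Borel function, and the library's
   integral, being a supremum over simple functions, ignores null sets. *)
Section bochner.
Context {R : realType} (X : Type) (V : set (X -> R)) (nrm : (X -> R) -> R).
Local Notation leb := (@lebesgue_measure R).

Definition simple_on (E : set R) (s : simple_vfun R X) : Prop :=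
  forall k, [/\ measurable (sv_set s k), sv_set s k `<=` E,
    (leb (sv_set s k) < +oo)%E & V (sv_val s k)].

Definition simple_eval (s : simple_vfun R X) (t : R) (x : X) : R :=
  \sum_(k < sv_size s) \1_(sv_set s k) t * sv_val s k x.

Definition simple_integral (s : simple_vfun R X) (x : X) : R :=
  \sum_(k < sv_size s) fine (leb (sv_set s k)) * sv_val s k x.

Definition strongly_measurable (E : set R) (w : R -> X -> R) : Prop :=
  {ae leb, forall t, E t -> V (w t)} /\
  exists2 s : nat -> simple_vfun R X, forall k, simple_on E (s k) &
    {ae leb, forall t, E t ->
      nrm (fun x => simple_eval (s k) t x - w t x) @[k --> \oo] --> 0}.

Definition bochner_L2 (E : set R) (w : R -> X -> R) : Prop :=
  strongly_measurable E w /\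
  (\int[leb]_(t in E) ((nrm (w t)) ^+ 2)%:E < +oo)%E.

(* A relation, as the Bochner integral is an element of V only up to nrm. *)
Definition is_bochner_integral (E : set R) (w : R -> X -> R) (v : X -> R) :=
  [/\ V v, strongly_measurable E w &
    exists s : nat -> simple_vfun R X, [/\ forall k, simple_on E (s k),
      (\int[leb]_(t in E)
          (nrm (fun x => simple_eval (s k) t x - w t x))%:E)%E
        @[k --> \oo] --> 0%E &
      nrm (fun x => simple_integral (s k) x - v x) @[k --> \oo] --> 0]].

End bochner.

Section pde.
Context {R : realType} {n : nat}.
Local Notation V := 'rV[R]_n.+1.
Local Notation leb := (@lebesgue_measure R).
Local Notation lebN := (@lebesgueN R n).
Implicit Types (Omega : set V) (f g w : V -> R).

Definition basis_vec (i : 'I_n.+1) : V := delta_mx ord0 i.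

Fixpoint Ck (k : nat) (f : V -> R) : Prop :=
  continuous f /\
  if k is k'.+1 then forall i,
    (forall x, derivable f x (basis_vec i)) /\ Ck k' ('D_(basis_vec i) f)
  else True.

Definition smooth f : Prop := forall k, Ck k f.

(* Near each boundary point, Omega is one side of the graph of a smooth
   function of the coordinates other than the i-th one. *)
Definition smooth_boundary Omega : Prop :=
  forall x0, (closure Omega `\` interior Omega) x0 ->
  exists (r : R) (i : 'I_n.+1) (s : bool) (gamma : V -> R),
  [/\ 0 < r, smooth gamma,
      forall x t, gamma (x + t *: basis_vec i) = gamma x &
      forall x, ball x0 r x -> (Omega x <-> gamma x < (-1) ^+ s * x ord0 i)].

Definition smooth_domain Omega : Prop :=
  [/\ Omega !=set0, open Omega, connected Omega, bounded_set Omega &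
      smooth_boundary Omega].

Definition C1_closure Omega f : Prop :=
  {within closure Omega, continuous f} /\
  forall i, exists2 g, {within closure Omega, continuous g} &
    forall x, Omega x -> is_derive x (basis_vec i) f (g x).

(* Here and below, functions represent their classes modulo equality a.e. in
   Omega; their values outside Omega are irrelevant. *)
Definition L2 Omega (f : V -> R) : Prop :=
  measurable_fun (Omega : set (Rn R n)) (f : Rn R n -> R) /\
  (\int[lebN]_(x in Omega) ((f x) ^+ 2)%:E < +oo)%E.

Definition L2dot Omega (f g : V -> R) : R :=
  \int[lebN]_(x in Omega) (f x * g x).

Definition L2norm Omega f : R := Num.sqrt (L2dot Omega f f).

Definition test_fun Omega (phi : V -> R) : Prop :=
  smooth phi /\ exists K : set V,
    [/\ compact K, K `<=` Omega & forall x, ~ K x -> phi x = 0].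

Definition is_weak_deriv Omega (i : 'I_n.+1) f g : Prop :=
  [/\ L2 Omega f, L2 Omega g & forall phi, test_fun Omega phi ->
    L2dot Omega f ('D_(basis_vec i) phi) = - L2dot Omega g phi].

(* A representative of the weak derivative in L^2 (unique a.e.), if any. *)
Definition wD Omega (i : 'I_n.+1) f : V -> R :=
  xget (fun=> 0) [set g | is_weak_deriv Omega i f g].

Definition H1 Omega f : Prop :=
  L2 Omega f /\ forall i, exists g, is_weak_deriv Omega i f g.

Definition H2 Omega f : Prop :=
  H1 Omega f /\ forall i, H1 Omega (wD Omega i f).

Definition H1norm Omega f : R :=
  Num.sqrt ((L2norm Omega f) ^+ 2 + \sum_i (L2norm Omega (wD Omega i f)) ^+ 2).

Definition H2norm Omega f : R :=
  Num.sqrt ((H1norm Omega f) ^+ 2 +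
    \sum_i \sum_j (L2norm Omega (wD Omega i (wD Omega j f))) ^+ 2).

Definition H10 Omega f : Prop :=
  H1 Omega f /\ exists2 phi : nat -> V -> R,
    forall k, test_fun Omega (phi k) &
    H1norm Omega (fun x => phi k x - f x) @[k --> \oo] --> 0.

Definition elliptic_coeffs Omega (a : 'I_n.+1 -> 'I_n.+1 -> V -> R)
    (c : V -> R) : Prop :=
  [/\ forall i j, C1_closure Omega (a i j),
      C1_closure Omega c,
      forall i j x, closure Omega x -> a i j x = a j i x,
      forall x, closure Omega x -> c x <= 0 &
      exists2 kappa : R, 0 < kappa & forall x (zeta : V), closure Omega x ->
        kappa * (\sum_i (zeta ord0 i) ^+ 2) <=
        \sum_i \sum_j a i j x * zeta ord0 i * zeta ord0 j].

(* Derivatives are weak; on dom_op, with C^1 coefficients, all of them exist. *)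
Definition elliptic_op Omega (a : 'I_n.+1 -> 'I_n.+1 -> V -> R) (c : V -> R)
    (w : V -> R) : V -> R :=
  fun x => - (\sum_i \sum_j
    wD Omega i (fun y => a i j y * wD Omega j w y) x) - c x * w x.

Definition dom_op Omega : set (V -> R) :=
  [set w | H2 Omega w /\ H10 Omega w].

Definition dom_op2 Omega a c : set (V -> R) :=
  [set w | dom_op Omega w /\ dom_op Omega (elliptic_op Omega a c w)].

Definition Gamma_fun (s : R) : R :=
  \int[leb]_(t in `]0, +oo[) (t `^ (s - 1) * expR (- t)).

Definition L2L2 Omega (T : R) (w : R -> V -> R) : Prop :=
  bochner_L2 (L2 Omega) (L2norm Omega) `]0, T[ w.

(* z = J^gamma w as elements of L^2(0,T;L^2(Omega)): equality for a.e. t. *)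
Definition is_Jfrac Omega (T gamma : R) (w z : R -> V -> R) : Prop :=
  {ae leb, forall t, 0 < t < T -> exists2 v : V -> R,
    is_bochner_integral (L2 Omega) (L2norm Omega) `]0, t[
      (fun s x => (t - s) `^ (gamma - 1) * w s x) v &
    ae_eq lebN Omega (z t) (fun x => (Gamma_fun gamma)^-1 * v x)}.

(* z belongs to H_gamma(0,T;L^2(Omega)) = J^gamma L^2(0,T;L^2(Omega)) and
   (J^gamma)^{-1} z is w; J^gamma is injective, so w is unique a.e. *)
Definition is_frac_deriv Omega (T gamma : R) (z w : R -> V -> R) : Prop :=
  L2L2 Omega T w /\ is_Jfrac Omega T gamma w z.

Definition Linfty (T : R) (mu : R -> R) : Prop :=
  measurable_fun `]0, T[ mu /\
  exists M : R, {ae leb, forall t, 0 < t < T -> `|mu t| <= M}.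

Definition is_solution Omega a c (T alpha : R) (u0 : V -> R) (mu : R -> R)
    (f : V -> R) (u : R -> V -> R) : Prop :=
  bochner_L2 (dom_op Omega) (H2norm Omega) `]0, T[ u /\
  exists2 w : R -> V -> R,
    is_frac_deriv Omega T alpha (fun t x => u t x - u0 x) w &
    {ae leb, forall t, 0 < t < T ->
      ae_eq lebN Omega (fun x => w t x + elliptic_op Omega a c (u t) x)
        (fun x => mu t * f x)}.

(* A solution is only determined for a.e. t; this selects its representative
   that is continuous from [0,T] to L^2(Omega) and equals u0 at t = 0. *)
Definition continuous_rep Omega (T : R) (u0 : V -> R) (u : R -> V -> R) : Prop :=
  [/\ forall t, 0 <= t <= T -> L2 Omega (u t),
      forall t, 0 <= t <= T ->
        L2norm Omega (fun x => u s x - u t x) @[s --> within `[0, T] (nbhs t)]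
          --> 0 &
      ae_eq lebN Omega (u 0) u0].

(* Some representative of the class of mu is mu0 + O(t) as t decreases to 0. *)
Definition initial_value (T : R) (mu : R -> R) (mu0 : R) : Prop :=
  exists2 m : R -> R, {ae leb, forall t, 0 < t < T -> m t = mu t} &
    (fun t => m t - mu0) =O_ (0^'+) (fun t => t).

End pde.

(* Main.v *)
(* Pairing the equation for u with psi and using that A is self-adjoint gives,
   for almost every t,
     (u(t), psi) = (a, psi)
       + Gamma(alpha)^-1 int_0^t (t - s)^(alpha - 1) h(s) ds,
   where h(s) = mu(s) (f, psi) - (u(s), A psi) tends to c_A as s -> 0 because u
   is continuous in L^2 at 0.  Hence (u(t), psi) = (a, psi)
   + c_A t^alpha / (alpha Gamma(alpha)) + o(t^alpha), and likewise for v;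
   comparing the two expansions along a sequence of times tending to 0 gives the
   three equalities.  Self-adjointness rests on two facts: a C^1 coefficient times
   an H^1 function is weakly differentiable (mollify the C^1 test functions), and
   weak derivatives are unique (test functions separate L^2). *)

(* Three obstacles shape the proof. The measure on R^N is only an outer measure given by boxes. What
   is drawn from it is that open sets are measurable, bounded sets have finite measure, translations
   preserve it, and measurable sets are approximated from outside by unions of boxes. Integration by
   parts therefore comes from differentiating a translation-invariant integral, not from iterated
   integrals. Next, the fractional derivative w is only strongly measurable and its Bochner integral
   is known through simple functions. So pairing and integral are not exchanged: if (w, psi) is
   within e of c_A near 0 and the kernel has integral K = t^alpha / alpha, the paired integral is
   shown to be within e K of c_A K. Finally, the equations hold for almost every t, so the
   comparison can only use some time in each interval ]0, d[. This suffices because c_A and c_B are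
   nonzero: letting t tend to 0 gives the constant terms, neither power can then be absorbed by the
   other, and equal exponents leave equal coefficients, in which the factors 1 / (alpha
   Gamma(alpha)) cancel. *)
From HB Require Import structures.
Require Import Defs.
From mathcomp Require Import all_boot all_order all_algebra.
From mathcomp Require Import all_classical all_reals all_analysis.
From mathcomp Require Import measurable_realfun ring lra.

Set Implicit Arguments.
Unset Strict Implicit.
Unset Printing Implicit Defensive.

Import Order.TTheory GRing.Theory Num.Theory.
Import numFieldNormedType.Exports.

Local Open Scope classical_set_scope.
Local Open Scope ring_scope.

(** * Lebesgue measure on R^n *)

Section lebesgueN_theory.
Context {R : realType} {n : nat}.
Local Notation V := 'rV[R]_n.+1.
Local Notation mu := (@lebesgueN R n).

Lemma le_lebesgueN (A B : set V) : A `<=` B -> (mu A <= mu B)%E.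
Proof. exact: le_lebesgue_outer. Qed.

(** Shifting every box of a cover by - v keeps its volume. Equality follows in the next lemma by
    applying this to - v. *)
Lemma lebesgue_outer_shift_le (A : set V) (v : V) :
  (lebesgue_outer R n [set x | A (x + v)%R] <= lebesgue_outer R n A)%E.
Proof.
apply: le_ereal_inf_tmp => _ [C CA <-].
apply: ereal_inf_lbound; exists (fun k => ((C k).1 - v, (C k).2 - v)).
  move=> x /= /CA[k _ Ck]; exists k => // i; have := Ck i.
  by rewrite !mxE ltrBlDr lerBrDr.
apply: eq_eseriesr => k _; congr EFin; apply: eq_bigr => i _.
by rewrite !mxE; congr Num.max; lra.
Qed.

Lemma lebesgue_outer_shift (A : set V) (v : V) :
  lebesgue_outer R n [set x | A (x + v)] = lebesgue_outer R n A.
Proof.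
apply/eqP; rewrite eq_le lebesgue_outer_shift_le/=.
apply: le_trans (lebesgue_outer_shift_le _ (- v)) => /=.
by apply: le_lebesgue_outer => x /=; rewrite subrK.
Qed.

(** Cut each box of a cover along the hyperplane x_i = r: the upper parts [C1] cover the piece
    above, the lower parts [C2] the piece below, and the volumes add up. *)
Lemma measurable_halfspace (i : 'I_n.+1) (r : R) :
  measurable ([set x | r < x ord0 i] : set (Rn R n)).
Proof.
apply: le_caratheodory_measurable => X /=.
apply: le_ereal_inf_tmp => _ [C CX <-].
pose C1 k : V * V := (\row_j (if j == i then Num.max ((C k).1 ord0 i) r
  else (C k).1 ord0 j), (C k).2).
pose C2 k : V * V := ((C k).1, \row_j (if j == i then Num.min ((C k).2 ord0 i) r
  else (C k).2 ord0 j)).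
have -> : (\sum_(k <oo) obox_vol (C k) =
    \sum_(k <oo) obox_vol (C1 k) + \sum_(k <oo) obox_vol (C2 k))%E.
  rewrite -nneseriesD; [|by move=> *; exact: obox_vol_ge0..].
  apply: eq_eseriesr => k _; rewrite /obox_vol -EFinD; congr EFin.
  rewrite [LHS](bigD1 i)//= [in RHS](bigD1 i)//=.
  rewrite [X in _ = _ + X](bigD1 i)//= !mxE !eqxx.
  under [X in _ = _ * X + _]eq_bigr => j /negbTE ji do rewrite !mxE ji.
  under [X in _ = _ + _ * X]eq_bigr => j /negbTE ji do rewrite !mxE ji.
  rewrite -mulrDl; congr (_ * _).
  move: ((C k).1 _ _) ((C k).2 _ _) => a b.
  (* If r misses the i-th side, one of the two boxes is inverted, and the maximum in [obox_vol]
     gives it volume 0. *)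
  rewrite /Num.max /Num.min.
  by case: (ltP a r) => ?; case: (ltP b r) => ?; repeat case: ltP => ?; lra.
apply: leeD; apply: ereal_inf_lbound.
  exists C1 => // x [/CX[k _ Ck] /= rx]; exists k => // j /=.
  have := Ck j; rewrite mxE; case: eqP => [->|//] /andP[? ?].
  by rewrite gt_max rx andbT; apply/andP.
exists C2 => // x [/CX[k _ Ck] /= /negP]; rewrite -leNgt => rx; exists k => // j /=.
have := Ck j; rewrite mxE; case: eqP => [->|//] /andP[? ?].
by rewrite le_min rx andbT; apply/andP.
Qed.

Lemma measurable_coord (i : 'I_n.+1) :
  measurable_fun setT ((fun x => x ord0 i) : Rn R n -> R).
Proof.
move=> _; apply: (measurability _ (RGenOInfty.measurableE R)) => //.
move=> _ [_ [r ->] <-]; rewrite setTI.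
have -> : (fun x : V => x ord0 i) @^-1` `]r, +oo[ = [set x : V | r < x ord0 i].
  by apply/seteqP; split => x /=; rewrite in_itv/= andbT.
exact: measurable_halfspace.
Qed.

Lemma measurable_obox (p : V * V) : measurable (obox p : set (Rn R n)).
Proof.
have -> : obox p = \bigcap_(i in [set: 'I_n.+1])
    ((fun x : V => x ord0 i) @^-1` `]p.1 ord0 i, p.2 ord0 i]).
  by apply/seteqP; split => x /= px i; have := px i; rewrite /= in_itv//= => /(_ I).
apply: fin_bigcap_measurable => // i _; rewrite -[X in measurable X]setTI.
by apply: measurable_coord.
Qed.

Lemma lebesgueN_obox (p : V * V) : (mu (obox p) <= obox_vol p)%E.
Proof.
(* The cover is padded by the degenerate box (0, 0), whose volume is 0 because the dimension is
   positive. *)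
apply: ereal_inf_lbound; exists (fun k => if k == 0%N then p else (0, 0)).
  by move=> x px; exists 0%N.
rewrite (@nneseriesD1 _ _ 0%N)//=; last by move=> *; exact: obox_vol_ge0.
rewrite eseries0 ?adde0// => k _ /=; case: eqP => // _ _.
by rewrite /obox_vol/= big_ord_recl/= mxE subrr maxxx mul0r.
Qed.

Lemma obox_vol_fin (p : V * V) : (obox_vol p < +oo)%E.
Proof. exact: ltry. Qed.

Lemma bounded_lebesgueN_fin (A : set V) : bounded_set A -> (mu A < +oo)%E.
Proof.
move=> [M [_ bM]]; pose N := M + 1; have bA x : A x -> `|x| <= N.
  by move=> Ax; apply: bM => //; rewrite /N; lra.
(* The left corner is lowered by 1 because [obox] excludes its left faces. *)
apply: le_lt_trans (obox_vol_fin (const_mx (- N - 1), const_mx N)).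
apply: le_trans (lebesgueN_obox _); apply: le_lebesgueN => x /bA xN i /=.
rewrite !mxE; have : `|x ord0 i| <= N.
  apply: le_trans xN; rewrite [`|x|]mx_normrE.
  by apply: (le_trans _ (le_bigmax _ _ (ord0, i))).
rewrite ler_norml => /andP[? ?]; apply/andP; split; lra.
Qed.

Definition cbox (p : V * V) : set V :=
  [set x | forall i, p.1 ord0 i <= x ord0 i <= p.2 ord0 i].

Definition oobox (p : V * V) : set V :=
  [set x | forall i, p.1 ord0 i < x ord0 i < p.2 ord0 i].

(** Enumerate the boxes with rational corners and replace those whose closed box leaves [A] by an
    inverted box, for which [cbox] is empty. Closed boxes inside [A] will be supports of bumps, and
    open boxes covering [A] are where the bumps are positive. *)
Lemma open_box_cover (A : set V) : open A ->
  exists C : nat -> V * V, (forall k, cbox (C k) `<=` A) /\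
    forall x, A x -> exists k, oobox (C k) x.
Proof.
move=> oA.
pose rv (q : 'rV[rat]_n.+1) : V := map_mx ratr q.
pose C k : V * V :=
  if unpickle k is Some q then
    if `[< cbox (rv q.1, rv q.2) `<=` A >] then (rv q.1, rv q.2)
    else (const_mx 1, const_mx 0)
  else (const_mx 1, const_mx 0).
have cbox0 : cbox (const_mx 1, const_mx 0) `<=` A.
  move=> x /(_ ord0) /=; rewrite !mxE => /andP[x1 x0].
  by have := le_trans x1 x0; rewrite ler10.
exists C; split => [k|x Ax].
  by rewrite /C; case: unpickle => // q; case: asboolP.
have /nbhs_ballP[e /= e0 xeA] := open_nbhs_nbhs (conj oA Ax).
have /choice[f fP] : forall i, exists q : rat,
    x ord0 i - e / 2 < (ratr q : R) < x ord0 i.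
  move=> i; have /rat_in_itvoo[q] : x ord0 i - e / 2 < x ord0 i by lra.
  by rewrite in_itv/= => ?; exists q.
have /choice[g gP] : forall i, exists q : rat,
    x ord0 i < (ratr q : R) < x ord0 i + e / 2.
  move=> i; have /rat_in_itvoo[q] : x ord0 i < x ord0 i + e / 2 by lra.
  by rewrite in_itv/= => ?; exists q.
exists (pickle (\row_i f i, \row_i g i)); rewrite /C pickleK.
case: asboolP => [_ i|[]] /=.
  by rewrite !mxE; have /andP[_ ->] := fP i; have /andP[-> _] := gP i.
move=> y /= yp; apply: xeA; split => // j i; rewrite ord1.
have := yp i; rewrite /= !mxE => /andP[fy yg].
have /andP[? ?] := fP i; have /andP[? ?] := gP i.
by rewrite /ball/= ltr_norml; apply/andP; split; lra.
Qed.

Lemma measurable_open (A : set V) : open A -> measurable (A : set (Rn R n)).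
Proof.
move=> /open_box_cover[C [CA AC]].
have -> : A = \bigcup_k obox (C k).
  apply/seteqP; split => x.
    move=> /AC[k Ck]; exists k => // i.
    by have /andP[-> /ltW ->] := Ck i.
  move=> [k _ Ck]; apply: (CA k) => i.
  by have /andP[/ltW -> ->] := Ck i.
by apply: bigcup_measurable => k _; exact: measurable_obox.
Qed.

Lemma measurable_closed (A : set V) : closed A -> measurable (A : set (Rn R n)).
Proof. by move/closed_openC/measurable_open/measurableC; rewrite setCK. Qed.

Lemma continuous_measurable_open (A : set V) (f : V -> R) : open A ->
  {in A, continuous f} -> measurable_fun (A : set (Rn R n)) (f : Rn R n -> R).
Proof.
move=> oA cf mA; apply: (measurability _ (RGenOInfty.measurableE R)) => //.
move=> _ [_ [r ->] <-]; apply: measurable_open.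
have cfs : {within A, continuous f} by rewrite continuous_open_subspace.
have /continuousP/(_ `]r, +oo[%classic (@interval_open _ (BRight r) +oo%O isT isT)) := cfs.
move=> oWf; have [W oW WA] := iffLR (open_subspaceP _ _) oWf.
by rewrite setIC -WA; apply: openI.
Qed.

Lemma continuous_measurableN (f : V -> R) :
  continuous f -> measurable_fun setT (f : Rn R n -> R).
Proof.
by move=> cf; apply: continuous_measurable_open => [|x _]; [exact: openT|exact: cf].
Qed.

Lemma measurable_shift (v : V) :
  measurable_fun setT ((fun x => x + v) : Rn R n -> Rn R n).
Proof.
move=> _ A mA; rewrite setTI.
have {}mA : caratheodory_measurable (lebesgue_outer R n) A by exact: mA.
suff H : caratheodory_measurable (lebesgue_outer R n) ((fun x : V => x + v) @^-1` A).
  exact: H.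
move=> X.
have := mA ((fun x => x - v) @^-1` X).
rewrite lebesgue_outer_shift => ->.
rewrite -(lebesgue_outer_shift _ v) -[X in (_ + X)%E](lebesgue_outer_shift _ v).
by congr (lebesgue_outer R n _ + lebesgue_outer R n _)%E;
  apply/seteqP; split => x /=; rewrite addrK.
Qed.

(** The image of [mu] under x -> x + v is [mu] again, by [lebesgue_outer_shift]. *)
Lemma ge0_integral_shift (f : V -> \bar R) (v : V) :
  measurable_fun setT (f : Rn R n -> \bar R) -> (forall x, 0 <= f x)%E ->
  (\int[mu]_x f (x + v)%R = \int[mu]_x f x)%E.
Proof.
move=> mf f0.
have := @ge0_integral_pushforward _ _ (Rn R n) (Rn R n) R _ (measurable_shift v)
  mu setT f measurableT mf (fun x _ => f0 x).
rewrite preimage_setT => <-.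
apply: (eq_measure_integral mu) => [|? A mA _]; first exact: measurable_shift.
exact: lebesgue_outer_shift.
Qed.

Lemma Rintegral_shift (f : V -> R) (v : V) :
  mu.-integrable setT (EFin \o (f : Rn R n -> R)) ->
  mu.-integrable setT (EFin \o ((fun x => f (x + v)) : Rn R n -> R)) /\
  \int[mu]_x f (x + v) = \int[mu]_x f x.
Proof.
move=> /[dup] intf /integrableP[mf foo].
have intfv : mu.-integrable setT (EFin \o ((fun x => f (x + v)) : Rn R n -> R)).
  apply/integrableP; split.
    exact: (measurableT_comp mf (measurable_shift v)).
  rewrite (@ge0_integral_shift (fun x => `|(f x)%:E|)%E v) => [//||x].
    exact: measurableT_comp.
  exact: abse_ge0.
split=> //.
rewrite /Rintegral [in LHS]integralE [in RHS]integralE; congr (fine (_ - _)%E).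
  have := @ge0_integral_shift ((EFin \o f)^\+)%E v (measurable_funepos mf)
    (funepos_ge0 _).
  by move=> /(etrans _); apply; apply: eq_integral => x _; rewrite !funeposE.
have := @ge0_integral_shift ((EFin \o f)^\-)%E v (measurable_funeneg mf)
  (funeneg_ge0 _).
by move=> /(etrans _); apply; apply: eq_integral => x _; rewrite !funenegE.
Qed.

End lebesgueN_theory.

(** * The space L^2 *)

Section L2_theory.
Context {R : realType} {n : nat}.
Local Notation V := 'rV[R]_n.+1.
Local Notation mu := (@lebesgueN R n).
Variable Omega : set V.
Hypothesis mO : measurable (Omega : set (Rn R n)).
Implicit Types f g h : V -> R.
Local Notation L2 := (L2 Omega).
Local Notation L2dot := (L2dot Omega).
Local Notation L2norm := (L2norm Omega).

Lemma L2_sqr_integrable f : L2 f ->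
  mu.-integrable Omega (EFin \o ((fun x => f x ^+ 2) : Rn R n -> R)).
Proof.
move=> [mf foo]; apply/integrableP; split.
  exact/measurable_EFinP/measurable_funX.
by apply: le_lt_trans foo; under eq_integral do
  rewrite /= ger0_norm ?sqr_ge0//.
Qed.

Lemma L2M_integrable f g : L2 f -> L2 g ->
  mu.-integrable Omega (EFin \o ((fun x => f x * g x) : Rn R n -> R)).
Proof.
move=> Lf Lg; have := integrableD mO (L2_sqr_integrable Lf) (L2_sqr_integrable Lg).
apply: le_integrable => //.
  by apply/measurable_EFinP/measurable_funM; [exact: Lf.1|exact: Lg.1].
move=> x _ /=; rewrite lee_fin [leRHS]ger0_norm ?addr_ge0 ?sqr_ge0//.
by rewrite ler_norml; apply/andP; split; nra.
Qed.

Lemma L2_ext f g : (forall x, Omega x -> f x = g x) -> L2 f -> L2 g.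
Proof.
move=> fg [mf foo]; split.
  by apply: eq_measurable_fun mf => x; rewrite inE => /fg.
by under eq_integral => x do [rewrite inE => Ox; rewrite -fg//].
Qed.

Lemma L2I f h : measurable_fun (Omega : set (Rn R n)) (f : Rn R n -> R) ->
  L2 h -> (forall x, Omega x -> `|f x| <= `|h x|) -> L2 f.
Proof.
move=> mf Lh fh; split=> //.
have /integrableP[_] : mu.-integrable Omega (EFin \o
    ((fun x => f x ^+ 2) : Rn R n -> R)).
  have := L2_sqr_integrable Lh; apply: le_integrable => //.
    exact/measurable_EFinP/measurable_funX.
  by move=> x Ox /=; rewrite lee_fin !normrX lerXn2r ?nnegrE ?fh.
by under eq_integral do rewrite /= ger0_norm ?sqr_ge0//.
Qed.

Lemma L2D f g : L2 f -> L2 g -> L2 (fun x => f x + g x).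
Proof.
move=> Lf Lg; split; first by apply: measurable_funD; [exact: Lf.1|exact: Lg.1].
have fg := L2M_integrable Lf Lg.
have /integrableP[_] : mu.-integrable Omega (EFin \o
    ((fun x => (f x + g x) ^+ 2) : Rn R n -> R)).
  apply: eq_integrable (integrableD mO (L2_sqr_integrable Lf)
    (integrableD mO (integrableD mO fg fg) (L2_sqr_integrable Lg))) => // x _.
  by rewrite /= -!EFinD; congr EFin; ring.
by under eq_integral do rewrite /= ger0_norm ?sqr_ge0//.
Qed.

Lemma L2Mbnd f h C : measurable_fun (Omega : set (Rn R n)) (h : Rn R n -> R) ->
  (forall x, Omega x -> `|h x| <= C) -> L2 f -> L2 (fun x => h x * f x).
Proof.
move=> mh hC Lf.
have mhf : measurable_fun (Omega : set (Rn R n)) ((fun x => h x * f x) : Rn R n -> R).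
  by apply: measurable_funM => //; exact: Lf.1.
split=> //; have /integrableP[_] : mu.-integrable Omega (EFin \o
    ((fun x => (h x * f x) ^+ 2) : Rn R n -> R)).
  have := integrableZl mO (C ^+ 2) (L2_sqr_integrable Lf).
  apply: le_integrable => //; first exact/measurable_EFinP/measurable_funX.
  move=> x Ox /=; rewrite lee_fin exprMn !normrM.
  have hxC := le_trans (hC _ Ox) (ler_norm C).
  by rewrite !ler_pM ?mulr_ge0.
by under eq_integral do rewrite /= ger0_norm ?sqr_ge0//.
Qed.

Lemma L2Z (a : R) f : L2 f -> L2 (fun x => a * f x).
Proof. by apply: (@L2Mbnd _ (fun=> a) `|a|); [exact: measurable_cst|]. Qed.

Lemma L2N f : L2 f -> L2 (fun x => - f x).
Proof. by move=> /(L2Z (-1)); apply: L2_ext => x _; rewrite mulN1r. Qed.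

Lemma L2B f g : L2 f -> L2 g -> L2 (fun x => f x - g x).
Proof. by move=> Lf /L2N; exact: L2D. Qed.

Lemma L2_0 : L2 (fun=> 0).
Proof.
split; first exact: measurable_cst.
by rewrite integral0_eq// => x _; rewrite expr0n.
Qed.

Lemma L2_sum I (r : seq I) (P : pred I) (F : I -> V -> R) :
  (forall i, P i -> L2 (F i)) -> L2 (fun x => \sum_(i <- r | P i) F i x).
Proof.
move=> LF; elim: r => [|i r IH]; first by apply: L2_ext L2_0 => x; rewrite big_nil.
case Pi: (P i); under eq_fun do rewrite big_cons Pi; last exact: IH.
by apply: L2D => //; exact: LF.
Qed.

Lemma L2dotC f g : L2dot f g = L2dot g f.
Proof. by apply: eq_Rintegral => x _; rewrite mulrC. Qed.

Lemma L2dotDl f g h : L2 f -> L2 g -> L2 h ->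
  L2dot (fun x => f x + g x) h = L2dot f h + L2dot g h.
Proof.
move=> Lf Lg Lh; rewrite /Defs.L2dot -RintegralD//; [|exact: L2M_integrable..].
by apply: eq_Rintegral => x _; rewrite mulrDl.
Qed.

Lemma L2dotZl a f h : L2 f -> L2 h ->
  L2dot (fun x => a * f x) h = a * L2dot f h.
Proof.
move=> Lf Lh; rewrite /Defs.L2dot -RintegralZl//; last exact: L2M_integrable.
by apply: eq_Rintegral => x _; rewrite mulrA.
Qed.

Lemma L2dotNl f h : L2 f -> L2 h -> L2dot (fun x => - f x) h = - L2dot f h.
Proof.
move=> Lf Lh; rewrite -mulN1r -L2dotZl//.
by apply: eq_Rintegral => x _; rewrite mulN1r.
Qed.

Lemma L2dotBl f g h : L2 f -> L2 g -> L2 h ->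
  L2dot (fun x => f x - g x) h = L2dot f h - L2dot g h.
Proof. by move=> Lf Lg Lh; rewrite (L2dotDl Lf (L2N Lg) Lh) (L2dotNl Lg Lh). Qed.

Lemma L2dotDr f g h : L2 f -> L2 g -> L2 h ->
  L2dot h (fun x => f x + g x) = L2dot h f + L2dot h g.
Proof. by move=> *; rewrite L2dotC L2dotDl// ![L2dot h _]L2dotC. Qed.

Lemma L2dotZr a f h : L2 f -> L2 h ->
  L2dot h (fun x => a * f x) = a * L2dot h f.
Proof. by move=> Lf Lh; rewrite L2dotC (L2dotZl a Lf Lh) L2dotC. Qed.

Lemma L2dot0l h : L2dot (fun=> 0) h = 0.
Proof.
rewrite /Defs.L2dot (@eq_Rintegral _ _ _ mu Omega (cst 0)); last first.
  by move=> x _; rewrite mul0r.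
by rewrite /Rintegral integral0.
Qed.

Lemma L2dot_suml I (r : seq I) (P : pred I) (F : I -> V -> R) h :
  (forall i, P i -> L2 (F i)) -> L2 h ->
  L2dot (fun x => \sum_(i <- r | P i) F i x) h =
  \sum_(i <- r | P i) L2dot (F i) h.
Proof.
move=> LF Lh; elim: r => [|i r IH].
  by rewrite big_nil; under eq_fun do rewrite big_nil; exact: L2dot0l.
rewrite big_cons; case Pi: (P i); under eq_fun do rewrite big_cons Pi; last exact: IH.
by rewrite (L2dotDl (LF i Pi) (@L2_sum _ r P F LF) Lh) IH.
Qed.

Lemma L2dot_ge0 f : 0 <= L2dot f f.
Proof. by apply: Rintegral_ge0 => x _; rewrite -expr2 sqr_ge0. Qed.

Lemma L2norm_ge0 f : 0 <= L2norm f.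
Proof. exact: sqrtr_ge0. Qed.

Lemma L2norm_sqr f : L2norm f ^+ 2 = L2dot f f.
Proof. by rewrite sqr_sqrtr ?L2dot_ge0. Qed.

Lemma L2_CS f g : L2 f -> L2 g -> `|L2dot f g| <= L2norm f * L2norm g.
Proof.
move=> Lf Lg; rewrite -ler_sqr ?nnegrE ?mulr_ge0 ?L2norm_ge0//.
rewrite exprMn !L2norm_sqr real_normK ?num_real//.
set F := L2dot f f; set G := L2dot g g; set X := L2dot f g.
have Q a b : 0 <= a ^+ 2 * F + 2 * a * b * X + b ^+ 2 * G.
  have La := L2Z a Lf; have Lb := L2Z b Lg; have Ls := L2D La Lb.
  have := L2dot_ge0 (fun x => a * f x + b * g x).
  rewrite (L2dotDl La Lb Ls) (L2dotZl a Lf Ls) (L2dotZl b Lg Ls).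
  rewrite (L2dotDr La Lb Lf) (L2dotDr La Lb Lg).
  rewrite (L2dotZr a Lf Lf) (L2dotZr b Lg Lf) (L2dotZr a Lf Lg) (L2dotZr b Lg Lg).
  by rewrite (L2dotC g f) -/F -/G -/X; lra.
(* For G = 0 and X nonzero, the coefficients 1 and - (F + 1) / (2 X) would give the form the value
   -1. Otherwise the coefficients G and - X give G (F G - X^2) >= 0. *)
have [G0|G0] := eqVneq G 0.
  have [->|X0] := eqVneq X 0; first by rewrite expr0n/= mulr_ge0// L2dot_ge0.
  have := Q 1 (- (F + 1) / (2 * X)).
  rewrite G0 (_ : _ + _ = -1) ?ler0N1//; last by field.
by have := Q G (- X); have := L2dot_ge0 g; rewrite -/G le0r (negbTE G0)/=; nra.
Qed.

Lemma L2dot_cvg (fk : nat -> V -> R) f h : (forall k, L2 (fk k)) -> L2 f -> L2 h ->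
  L2norm (fun x => fk k x - f x) @[k --> \oo] --> 0 ->
  L2dot (fk k) h @[k --> \oo] --> L2dot f h.
Proof.
move=> Lfk Lf Lh fkf; apply/subr_cvg0; apply: norm_cvg0.
apply: (@squeeze_cvgr _ _ _ _ (fun=> 0)
    (fun k => L2norm (fun x => fk k x - f x) * L2norm h)); last 2 first.
- exact: cvg_cst.
- by rewrite -(mul0r (L2norm h)); apply: cvgMl.
apply: nearW => k; rewrite normr_ge0/= -(L2dotBl (Lfk k) Lf Lh).
exact: (L2_CS (L2B (Lfk k) Lf) Lh).
Qed.

(** Measurability passes to [g] because a measure obtained by the Caratheodory construction is
    complete. *)
Lemma L2_ae f g : ae_eq mu (Omega : set (Rn R n)) (f : Rn R n -> R) g -> L2 f -> L2 g.
Proof.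
move=> fg [mf foo].
have mg : measurable_fun (Omega : set (Rn R n)) (g : Rn R n -> R).
  have cmu : measure_is_complete mu by exact: measure_is_complete_caratheodory.
  apply/measurable_EFinP.
  apply: (@ae_measurable_fun _ _ _ mu cmu Omega (EFin \o (f : Rn R n -> R))).
    by apply: filterS fg => x fgx Ox /=; rewrite fgx.
  exact/measurable_EFinP.
split; first exact: mg.
have mf2 : measurable_fun (Omega : set (Rn R n)) (fun x : Rn R n => (f x ^+ 2)%:E).
  exact/measurable_EFinP/measurable_funX.
have mg2 : measurable_fun (Omega : set (Rn R n)) (fun x : Rn R n => (g x ^+ 2)%:E).
  exact/measurable_EFinP/measurable_funX.
rewrite -(@ae_eq_integral _ _ _ mu Omega _ _ mO mf2 mg2)//.
by apply: filterS fg => x fgx Ox; rewrite fgx.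
Qed.

Lemma L2dot_ae f g h : ae_eq mu (Omega : set (Rn R n)) (f : Rn R n -> R) g ->
  L2 f -> L2 h -> L2dot f h = L2dot g h.
Proof.
move=> fg Lf Lh; have Lg := L2_ae fg Lf.
have mfh := measurable_int mu (L2M_integrable Lf Lh).
have mgh := measurable_int mu (L2M_integrable Lg Lh).
apply: (congr1 fine); apply: (@ae_eq_integral _ _ _ mu Omega _ _ mO mfh mgh).
by apply: filterS fg => x fgx Ox; rewrite /= fgx.
Qed.

Hypothesis Ofin : (mu Omega < +oo)%E.

Lemma L2_cst C : L2 (fun=> C).
Proof.
split; first exact: measurable_cst.
have /= -> := integral_cst mu mO (C ^+ 2)%:E.
by rewrite lte_mul_pinfty// lee_fin sqr_ge0.
Qed.

Lemma L2_bounded f C : measurable_fun (Omega : set (Rn R n)) (f : Rn R n -> R) ->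
  (forall x, Omega x -> `|f x| <= C) -> L2 f.
Proof.
move=> mf fC; apply: (L2I mf (L2_cst C)) => x /fC fxC.
by rewrite (le_trans fxC)// ler_norm.
Qed.

Lemma L2norm_bounded f C : measurable_fun (Omega : set (Rn R n)) (f : Rn R n -> R) ->
  0 <= C -> (forall x, Omega x -> `|f x| <= C) ->
  L2norm f <= C * Num.sqrt (fine (mu Omega)).
Proof.
move=> mf C0 fC; have Lf := L2_bounded mf fC.
rewrite -ler_sqr ?nnegrE ?mulr_ge0 ?L2norm_ge0 ?sqrtr_ge0//.
rewrite L2norm_sqr exprMn sqr_sqrtr ?fine_ge0//.
rewrite -(Rintegral_cst mu mO (C ^+ 2)); apply: le_Rintegral => //.
- exact: L2M_integrable.
- exact: (L2_sqr_integrable (L2_cst C)).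
- by move=> x Ox /=; have := fC _ Ox; rewrite ler_norml => /andP[? ?]; nra.
Qed.

End L2_theory.

(** * Smooth functions *)

Section directional.
Context {R : realType} {n : nat}.
Local Notation V := 'rV[R]_n.+1.

(** Both sides are the same difference quotient, which lets one-variable calculus handle directional
    derivatives. *)
Let quotient_line (f : V -> R) (x v : V) (t : R) :
  (fun h : R => h^-1 *: (((fun s : R => f (x + s *: v)) \o shift t) (h *: 1)
     - f (x + t *: v))) =
  (fun h => h^-1 *: ((f \o shift (x + t *: v)) (h *: v) - f (x + t *: v))).
Proof.
apply/funext => h /=.
by congr (_ *: (f _ - f _)); rewrite scalerDl [_%:A]mulr1 addrCA addrC.
Qed.

Lemma derivable_line (f : V -> R) (x v : V) (t : R) :
  derivable (fun s : R => f (x + s *: v)) t 1 = derivable f (x + t *: v) v.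
Proof. by rewrite /derivable quotient_line. Qed.

Lemma derive_line (f : V -> R) (x v : V) (t : R) :
  'D_1 (fun s : R => f (x + s *: v)) t = 'D_v f (x + t *: v).
Proof. by rewrite /derive quotient_line. Qed.

Lemma is_derive_line (f : V -> R) (x v : V) (t l : R) :
  is_derive t 1 (fun s : R => f (x + s *: v)) l <-> is_derive (x + t *: v) v f l.
Proof.
split=> -[df Df].
  by apply: DeriveDef; [rewrite -derivable_line|rewrite -derive_line].
by apply: DeriveDef; [rewrite derivable_line|rewrite derive_line].
Qed.

Lemma CkW k (f : V -> R) : Ck k.+1 f -> Ck k f.
Proof.
elim: k f => [|k IH] f; first by move=> [].
move=> [cf Df]; split=> // i; have [df Df'] := Df i.
by split=> //; exact: IH.
Qed.

Lemma CkD k (f g : V -> R) : Ck k f -> Ck k g -> Ck k (fun x => f x + g x).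
Proof.
elim: k f g => [|k IH] f g [cf Df] [cg Dg].
  by split=> // x; apply: continuousD; [exact: cf|exact: cg].
split; first by move=> x; apply: continuousD; [exact: cf|exact: cg].
move=> i; have [df Df'] := Df i; have [dg Dg'] := Dg i; split.
  by move=> x; exact: derivableD.
rewrite (_ : 'D_(basis_vec i) _ =
  fun x => 'D_(basis_vec i) f x + 'D_(basis_vec i) g x); first exact: IH.
by apply/funext => x; exact: deriveD.
Qed.

Lemma CkM k (f g : V -> R) : Ck k f -> Ck k g -> Ck k (fun x => f x * g x).
Proof.
elim: k f g => [|k IH] f g.
  by move=> [cf Df] [cg Dg]; split=> // x; apply: continuousM; [exact: cf|exact: cg].
move=> Cf Cg; move: (Cf) (Cg) => [cf Df] [cg Dg].
split; first by move=> x; apply: continuousM; [exact: cf|exact: cg].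
move=> i; have [df Df'] := Df i; have [dg Dg'] := Dg i; split.
  by move=> x; exact: derivableM.
rewrite (_ : 'D_(basis_vec i) _ =
  fun x => f x * 'D_(basis_vec i) g x + g x * 'D_(basis_vec i) f x).
  by apply: CkD; apply: IH => //; exact: CkW.
by apply/funext => x; rewrite (deriveM (df x) (dg x)).
Qed.

Lemma Ck_cst k (a : R) : Ck k (fun _ : V => a).
Proof.
elim: k a => [|k IH] a; first by split=> //; exact: cst_continuous.
split; first exact: cst_continuous.
move=> i; split; first by move=> x; exact: derivable_cst.
rewrite (_ : 'D_(basis_vec i) _ = fun=> 0); first exact: IH.
by apply/funext => x; exact: derive_cst.
Qed.

Lemma smoothD (f g : V -> R) : smooth f -> smooth g -> smooth (fun x => f x + g x).
Proof. by move=> sf sg k; apply: CkD. Qed.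

Lemma smoothM (f g : V -> R) : smooth f -> smooth g -> smooth (fun x => f x * g x).
Proof. by move=> sf sg k; apply: CkM. Qed.

Lemma smooth_cst (a : R) : smooth (fun _ : V => a).
Proof. by move=> k; exact: Ck_cst. Qed.

Lemma smoothZ a (f : V -> R) : smooth f -> smooth (fun x => a * f x).
Proof. by apply: smoothM; exact: smooth_cst. Qed.

Lemma smoothB (f g : V -> R) : smooth f -> smooth g -> smooth (fun x => f x - g x).
Proof.
move=> sf /(smoothZ (-1)) /(smoothD sf).
by under eq_fun do rewrite mulN1r.
Qed.

Lemma smooth_prod I (r : seq I) (F : I -> V -> R) :
  (forall i, smooth (F i)) -> smooth (fun x => \prod_(i <- r) F i x).
Proof.
move=> sF; elim: r => [|i r IH].
  by under eq_fun do rewrite big_nil; exact: smooth_cst.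
by under eq_fun do rewrite big_cons; exact: smoothM.
Qed.

Lemma smooth_continuous (f : V -> R) : smooth f -> continuous f.
Proof. by move=> /(_ 0%N) []. Qed.

Lemma smooth_derivable (f : V -> R) i x : smooth f -> derivable f x (basis_vec i).
Proof. by move=> /(_ 1%N) [_ /(_ i)[]]. Qed.

Lemma smooth_derive (f : V -> R) i : smooth f -> smooth ('D_(basis_vec i) f).
Proof. by move=> sf k; have [_ /(_ i)[]] := sf k.+1. Qed.

(* The induction on k requires a family F closed under differentiation, the
   derivative of F p being F (D p). *)
Lemma Ck_coord I (F : I -> R -> R) (D : I -> I) :
  (forall p (x : R), is_derive x 1 (F p) (F (D p) x)) ->
  forall k p (a b : R) (j : 'I_n.+1), Ck k (fun x : V => F p (a * x ord0 j + b)).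
Proof.
move=> dF; have cF p : continuous (F p).
  by move=> x; apply/differentiable_continuous/derivable1_diffP; case: (dF p x).
have cc p (a b : R) (j : 'I_n.+1) : continuous (fun x : V => F p (a * x ord0 j + b)).
  move=> x; apply: (@continuous_comp _ _ _ (fun x : V => a * x ord0 j + b) (F p)).
    apply: continuousD; last exact: cst_continuous.
    by apply: continuousM; [exact: cst_continuous|exact: coord_continuous].
  exact: cF.
have dc p (a b : R) (j i : 'I_n.+1) (x : V) :
    is_derive x (basis_vec i) (fun x : V => F p (a * x ord0 j + b))
      ((i == j)%:R * a * F (D p) (a * x ord0 j + b)).
  rewrite -[X in is_derive X _ _ _]addr0 -(scale0r (basis_vec i)).
  apply/is_derive_line.
  pose G t := a * ((i == j)%:R * t) + (a * x ord0 j + b).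
  rewrite (_ : (fun s => _) = F p \o G); last first.
    apply/funext => s; rewrite /G /= !mxE eqxx/= eq_sym; congr (F p _); ring.
  have -> : a * x ord0 j + b = G 0 by rewrite /G; ring.
  rewrite mulrC; apply: is_derive1_comp.
  rewrite (_ : G = ((a * (i == j)%:R) \*: id) + cst (a * x ord0 j + b)); last first.
    by apply/funext => t; rewrite /G mulrA.
  by apply: is_derive_eq; rewrite addr0 [LHS]mulr1 mulrC.
elim=> [|k IH] p a b j; split => //.
move=> i; split; first by move=> x; case: (dc p a b j i x).
rewrite (_ : 'D_(basis_vec i) _ =
    fun x => ((i == j)%:R * a) * F (D p) (a * x ord0 j + b)).
  by apply: CkM => //; exact: Ck_cst.
by apply/funext => x; case: (dc p a b j i x).
Qed.

End directional.

(** * A smooth function on the line vanishing on the negative half-line *)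

Section bump.
Context {R : realType}.

(* bump_poly 1 x = exp (- 1 / x) for x > 0; the polynomial factors make the
   family closed under differentiation. *)
Definition bump_poly (p : {poly R}) (x : R) : R :=
  if 0 < x then p.[x^-1] * expR (- x^-1) else 0.

(** One term of the exponential series gives y^k exp(- y) <= k!; these bounds are summed with the
    absolute values of the coefficients. *)
Lemma polyM_expRN_bounded (p : {poly R}) :
  exists C : R, forall y, 0 < y -> `|p.[y] * expR (- y)| <= C.
Proof.
have mono k y : 0 < y -> y ^+ k * expR (- y) <= (k`!)%:R.
  move=> y0; rewrite expRN ler_pdivrMr ?expR_gt0//.
  case: k => [|k]; first by rewrite fact0 mul1r expr0 -expR0 ler_expR ltW.
  have := expR_ge1Dxn k (ltW y0).
  have f0 : 0 < (k.+1`!)%:R :> R by rewrite ltr0n fact_gt0.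
  rewrite -ler_pdivrMl// mulrC => H; apply: le_trans H; lra.
exists (\sum_(i < size p) `|p`_i| * (i`!)%:R) => y y0.
rewrite normrM (ger0_norm (expR_ge0 _)) horner_coef.
apply: le_trans (ler_wpM2r (expR_ge0 _) (ler_norm_sum _ _ _)) _.
rewrite mulr_suml; apply: ler_sum => i _.
rewrite normrM -mulrA ler_wpM2l// (ger0_norm (exprn_ge0 _ (ltW y0))); exact: mono.
Qed.

(** With y = 1 / x, d/dx is - y^2 d/dy, which sends p(y) exp(- y) to y^2 (p - p')(y) exp(- y). The
    only delicate point is x = 0. *)
Lemma is_derive_bump_poly (p : {poly R}) (x : R) :
  is_derive x 1 (bump_poly p) (bump_poly ('X^2 * (p - p^`())) x).
Proof.
have [x0|x0|->] := ltgtP x 0.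
- rewrite [X in is_derive _ _ _ X]/bump_poly ltNge (ltW x0)/=.
  apply: (near_eq_is_derive _ (is_derive_cst (0 : R) x 1)).
  near=> y; rewrite /bump_poly ltNge.
  by have -> : y <= 0 by apply/ltW; near: y; exact: lt_nbhsl.
- rewrite [X in is_derive _ _ _ X]/bump_poly x0.
  have dV : is_derive x 1 (fun y : R => y^-1) (- x ^- 2).
    have := @is_deriveV R id x 1 1 (lt0r_neq0 x0) (is_derive_id x 1).
    by rewrite [_ *: 1]mulr1.
  have dp : is_derive x^-1 1 (horner p) p^`().[x^-1].
    apply: DeriveDef; first exact: derivable_horner.
    by rewrite -derive1E derivE.
  have dpV := is_derive1_comp dp dV.
  have dN : is_derive x 1 (fun y : R => - y^-1) (- - x ^- 2) by exact: is_deriveN.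
  have deV := @is_derive1_comp R expR (fun y => - y^-1) x _ _ (is_derive_expR _) dN.
  have H := is_deriveM dpV deV.
  apply: (near_eq_is_derive _ (is_derive_eq H _)).
    by near=> y; rewrite /bump_poly; have -> : 0 < y by near: y; exact: lt_nbhsr.
  rewrite !hornerE /= exprVn opprK /GRing.scale/=; ring.
- rewrite [X in is_derive _ _ _ X]/bump_poly ltxx.
  (* For h > 0 the difference quotient at 0 is p(1/h) h^-1 exp(- 1/h). Multiplying [p] by X^2 spares
     one factor h, so the quotient is at most C h. *)
  have [C HC] := polyM_expRN_bounded (p * 'X^2).
  have C0 : 0 <= C by apply: le_trans (HC 1 ltr01).
  have lim0 : h^-1 *: ((bump_poly p \o shift 0) (h *: 1) - bump_poly p 0)
      @[h --> 0^'] --> (0 : R).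
    apply: norm_cvg0; apply: (@squeeze_cvgr _ _ _ _ (fun=> 0) (fun h : R => C * `|h|)).
    + near=> h; rewrite normr_ge0/= /bump_poly ltxx subr0 addr0 [h *: 1]mulr1.
      case: ifPn => h0; last by rewrite scaler0 normr0 mulr_ge0.
      have := HC h^-1; rewrite invr_gt0 => /(_ h0); rewrite !hornerE.
      rewrite -(@ler_pM2r _ `|h|) ?normr_gt0 ?gt_eqF//; apply: le_trans.
      rewrite -normrM le_eqVlt; apply/orP; left; apply/eqP; congr (`|_|).
      by rewrite /GRing.scale/=; field; rewrite gt_eqF.
    + exact: cvg_cst.
    + have : C * `|h| @[h --> (0 : R)^'] --> C * `|0 : R|.
        by apply: cvgMr; apply: cvg_within_filter; exact: norm_continuous.
      by rewrite normr0 mulr0.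
  by apply: DeriveDef; [apply/cvg_ex; exists 0|apply/cvg_lim].
Unshelve. all: by end_near. Qed.

Lemma bump_poly1_ge0 x : 0 <= bump_poly 1 x.
Proof. by rewrite /bump_poly; case: ifP => // _; rewrite hornerC mul1r expR_ge0. Qed.

Lemma bump_poly1_le1 x : bump_poly 1 x <= 1.
Proof.
rewrite /bump_poly; case: ifP => // x0; rewrite hornerC mul1r -expR0 ler_expR.
by rewrite oppr_le0 invr_ge0 ltW.
Qed.

Lemma bump_poly1_eq0 x : x <= 0 -> bump_poly 1 x = 0.
Proof. by rewrite /bump_poly leNgt => /negbTE ->. Qed.

Lemma bump_poly1_gt0 x : 0 < x -> 0 < bump_poly 1 x.
Proof. by rewrite /bump_poly => ->; rewrite hornerC mul1r expR_gt0. Qed.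

(** Rescaled bumps tend pointwise to the indicator of the open half-line; products over the
    coordinates then approximate indicators of boxes. *)
Lemma bump_poly1_cvg x : bump_poly 1 (k.+1%:R * x) @[k --> \oo] --> (((0 < x)%R)%:R : R).
Proof.
have [x0|x0] := ltP 0 x; last first.
  rewrite (_ : (fun k => _) = fun=> 0); first exact: cvg_cst.
  by apply/funext => k; rewrite bump_poly1_eq0// mulr_ge0_le0.
rewrite (_ : (fun k => _) = fun k => expR (- (k.+1%:R^-1 * x^-1))); last first.
  apply/funext => k; rewrite /bump_poly pmulr_lgt0// ltr0Sn hornerC mul1r.
  by rewrite invfM.
have -> : true%:R = expR (- (0 * x^-1)) :> R by rewrite mul0r oppr0 expR0.
apply: continuous_cvg; first exact: continuous_expR.
by apply: cvgN; apply: cvgMl; exact: cvg_harmonic.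
Qed.

End bump.

(** * Test functions and smooth approximations of box indicators *)

Section test_functions.
Context {R : realType} {n : nat}.
Local Notation V := 'rV[R]_n.+1.
Local Notation mu := (@lebesgueN R n).

Lemma rV_norm_le (x : V) (c : R) : 0 <= c ->
  (forall i, `|x ord0 i| <= c) -> `|x| <= c.
Proof.
move=> c0 xc; rewrite [`|x|]mx_normrE; apply: bigmax_le => // -[i j] _ /=.
by rewrite ord1.
Qed.

Lemma rV_coord_le (x : V) i : `|x ord0 i| <= `|x|.
Proof.
by rewrite [`|x|]mx_normrE; apply: (le_trans _ (le_bigmax _ _ (ord0, i))).
Qed.

Lemma compact_cbox (p : V * V) : compact (cbox p).
Proof.
apply: bounded_closed_compact.
  exists (`|p.1| + `|p.2|); split; first exact: num_real.
  move=> M pM x px; apply/ltW/le_lt_trans/pM; apply: rV_norm_le.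
    by rewrite addr_ge0.
  move=> i; have /andP[xl xr] := px i.
  have := rV_coord_le p.1 i; have := rV_coord_le p.2 i.
  rewrite !ler_norml => /andP[? ?] /andP[? ?]; apply/andP.
  have := normr_ge0 p.1; have := normr_ge0 p.2.
  by split; lra.
have -> : cbox p = \bigcap_(i in [set: 'I_n.+1])
    ((fun x : V => x ord0 i) @^-1` `[p.1 ord0 i, p.2 ord0 i]).
  by apply/seteqP; split => x /= px i; have := px i; rewrite /= in_itv//= => /(_ I).
apply: closed_bigI => i _; apply: closed_comp; last exact: interval_closed.
by move=> x _; exact: coord_continuous.
Qed.

Lemma compact_support_bounded (f : V -> R) (K : set V) :
  compact K -> continuous f -> (forall x, ~ K x -> f x = 0) ->
  exists2 C : R, 0 <= C & forall x, `|f x| <= C.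
Proof.
move=> cK cf f0.
have /compact_bounded[M [_ HM]] : compact (f @` K).
  by apply: continuous_compact => //; exact: continuous_subspaceT.
exists (`|M| + 1) => [|x]; first by rewrite addr_ge0.
have [Kx|/f0->] := pselect (K x); last by rewrite normr0 addr_ge0.
by apply: HM; [have := ler_norm M; lra|exists x].
Qed.

Lemma compact_closedN (K : set V) : compact K -> closed K.
Proof. by apply: compact_closed; exact: norm_hausdorff. Qed.

Lemma derive_off_support (f : V -> R) (K : set V) (v : V) : compact K ->
  (forall x, ~ K x -> f x = 0) -> forall x, ~ K x -> is_derive x v f 0.
Proof.
move=> cK f0 x Kx; apply: (near_eq_is_derive _ (is_derive_cst (0 : R) x v)).
have oK : open (~` K) by apply: closed_openC; exact: compact_closedN cK.
have : nbhs x (~` K) by exact: open_nbhs_nbhs.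
by apply: filterS => y /f0 ->.
Qed.

Variable Omega : set V.
Hypothesis oO : open Omega.
Hypothesis bO : bounded_set Omega.
Let mO : measurable (Omega : set (Rn R n)) := measurable_open oO.
Let Ofin : (mu Omega < +oo)%E := bounded_lebesgueN_fin bO.
Local Notation L2 := (L2 Omega).
Local Notation L2dot := (L2dot Omega).
Local Notation L2norm := (L2norm Omega).

Lemma test_bounded phi : test_fun Omega phi ->
  exists2 C : R, 0 <= C & forall x, `|phi x| <= C.
Proof.
move=> [sphi [K [cK _ phi0]]]; apply: (compact_support_bounded cK) => //.
exact: smooth_continuous.
Qed.

Lemma continuous_measurableO (f : V -> R) : continuous f ->
  measurable_fun (Omega : set (Rn R n)) (f : Rn R n -> R).
Proof. by move=> cf; apply: continuous_measurable_open => // x _; exact: cf. Qed.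

Lemma test_measurable phi : test_fun Omega phi ->
  measurable_fun (Omega : set (Rn R n)) (phi : Rn R n -> R).
Proof. by move=> [/smooth_continuous ? _]; exact: continuous_measurableO. Qed.

Lemma test_L2 phi : test_fun Omega phi -> L2 phi.
Proof.
move=> tphi; have [C _ phiC] := test_bounded tphi.
by apply: (L2_bounded mO Ofin (test_measurable tphi)) => x _; exact: phiC.
Qed.

Lemma test_derive phi i : test_fun Omega phi ->
  test_fun Omega ('D_(basis_vec i) phi).
Proof.
move=> [sphi [K [cK KO phi0]]]; split; first exact: smooth_derive.
exists K; split=> // x Kx.
by have [_ ->] := derive_off_support (basis_vec i) cK phi0 Kx.
Qed.

Lemma test_smoothM h phi : smooth h -> test_fun Omega phi ->
  test_fun Omega (fun x => h x * phi x).
Proof.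
move=> sh [sphi [K [cK KO phi0]]]; split; first exact: smoothM.
by exists K; split=> // x /phi0 ->; rewrite mulr0.
Qed.

(** Dominated convergence with the majorant C |G|, which is integrable because [Omega] has finite
    measure. *)
Lemma L2dot_dct (F_ : nat -> V -> R) (F G : V -> R) (C : R) : L2 G ->
  (forall m, measurable_fun (Omega : set (Rn R n)) (F_ m : Rn R n -> R)) ->
  (forall m x, Omega x -> `|F_ m x| <= C) ->
  (forall x, Omega x -> F_ m x @[m --> \oo] --> F x) ->
  L2dot G (F_ m) @[m --> \oo] --> L2dot G F.
Proof.
move=> LG mF FC Fcvg.
have L1 : L2 (fun=> C) by exact: L2_cst.
have iG : mu.-integrable Omega (EFin \o ((fun x => C * `|G x|) : Rn R n -> R)).
  have LaG : L2 (fun x => `|G x|).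
    apply: (L2I mO _ LG) => [|x _]; last by rewrite normr_id.
    by apply: measurableT_comp => //; exact: LG.1.
  exact: (L2M_integrable mO L1 LaG).
have LF m : L2 (F_ m) by exact: L2_bounded (FC m).
have fin m : (\int[mu]_(x in Omega) (G x * F_ m x)%:E)%E \is a fin_num.
  apply: integrable_fin_num => //; exact: L2M_integrable.
have H : (\int[mu]_(x in Omega) (G x * F_ m x)%:E @[m --> \oo] -->
    \int[mu]_(x in Omega) (G x * F x)%:E)%E.
  apply: (dominated_cvg mO _ _ _ iG).
  - by move=> m; exact: (measurable_int mu (L2M_integrable mO LG (LF m))).
  - move=> x Ox; apply: cvg_EFin; first exact: nearW.
    by apply: cvgMr; exact: Fcvg.
  - by [].
  - move=> m x Ox /=; rewrite lee_fin normrM mulrC ler_wpM2r//; exact: FC.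
apply: fine_cvg; rewrite fineK//.
apply: integrable_fin_num => //; apply: L2M_integrable => //.
apply: (@L2_bounded _ _ _ mO Ofin _ C).
  apply/measurable_EFinP; apply: (emeasurable_fun_cvg
    (fun m => EFin \o (F_ m : Rn R n -> R))) => [m|x Ox].
    by apply/measurable_EFinP; exact: mF.
  by apply: cvg_EFin; [exact: nearW|exact: Fcvg].
move=> x Ox; have : `|F_ m x| @[m --> \oo] --> `|F x| by apply: cvg_norm; exact: Fcvg.
by move/cvgr_to_le; apply; apply: nearW => m; exact: FC.
Qed.

(** Vanishes off [cbox p] and tends to 1 on [oobox p]; also serves, with m = 0, as the mollifying
    kernel. *)
Definition box_bump (p : V * V) (m : nat) (x : V) : R :=
  \prod_(i < n.+1) (bump_poly 1 (m.+1%:R * (x ord0 i - p.1 ord0 i)) *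
    bump_poly 1 (m.+1%:R * (p.2 ord0 i - x ord0 i))).

(** The second factor is 1 up to and including the right face, so the pointwise limit is exactly the
    indicator of the half-open box. The support is unbounded in general, so this is multiplied by a
    test function when used. *)
Definition obox_bump (p : V * V) (m : nat) (x : V) : R :=
  \prod_(i < n.+1) (bump_poly 1 (m.+1%:R * (x ord0 i - p.1 ord0 i)) *
    (1 - bump_poly 1 (m.+1%:R * (x ord0 i - p.2 ord0 i)))).

Lemma smooth_bump_coord (a b : R) (i : 'I_n.+1) :
  smooth (fun x : V => bump_poly 1 (a * x ord0 i + b)).
Proof.
by move=> k; apply: (@Ck_coord _ _ _ bump_poly (fun p => 'X^2 * (p - p^`())));
  exact: is_derive_bump_poly.
Qed.

Lemma smooth_box_bump p m : smooth (box_bump p m).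
Proof.
apply: smooth_prod => i; apply: smoothM.
  by under eq_fun do rewrite mulrBr; exact: smooth_bump_coord.
by under eq_fun do rewrite mulrBr -mulNr addrC; exact: smooth_bump_coord.
Qed.

Lemma smooth_obox_bump p m : smooth (obox_bump p m).
Proof.
apply: smooth_prod => i; apply: smoothM.
  by under eq_fun do rewrite mulrBr; exact: smooth_bump_coord.
apply: smoothB; first exact: smooth_cst.
by under eq_fun do rewrite mulrBr; exact: smooth_bump_coord.
Qed.

Lemma prodr_itv01 I (r : seq I) (F : I -> R) : (forall i, 0 <= F i <= 1) ->
  0 <= \prod_(i <- r) F i <= 1.
Proof.
move=> F01; rewrite prodr_ile1 ?andbT//; apply: prodr_ge0 => i _.
by have /andP[] := F01 i.
Qed.

Lemma cvg_prodr I (r : seq I) (F : I -> nat -> R) (L : I -> R) :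
  (forall i, F i m @[m --> \oo] --> L i) ->
  \prod_(i <- r) F i m @[m --> \oo] --> \prod_(i <- r) L i.
Proof.
move=> FL; elim: r => [|i r IH].
  by under eq_fun do rewrite big_nil; rewrite big_nil; exact: cvg_cst.
by under eq_fun do rewrite big_cons; rewrite big_cons; exact: cvgM.
Qed.

Lemma box_bump_itv p m x : 0 <= box_bump p m x <= 1.
Proof.
apply: prodr_itv01 => i.
by rewrite mulr_ge0 ?bump_poly1_ge0// mulr_ile1 ?bump_poly1_ge0 ?bump_poly1_le1.
Qed.

Lemma obox_bump_itv p m x : 0 <= obox_bump p m x <= 1.
Proof.
apply: prodr_itv01 => i.
rewrite mulr_ge0 ?bump_poly1_ge0 ?subr_ge0 ?bump_poly1_le1//.
rewrite mulr_ile1 ?bump_poly1_ge0 ?subr_ge0 ?bump_poly1_le1//.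
by rewrite gerBl bump_poly1_ge0.
Qed.

Lemma box_bump_eq0 p m x : ~ cbox p x -> box_bump p m x = 0.
Proof.
move=> px; have /existsNP[i /negP] := px.
rewrite negb_and -!ltNge => H; rewrite /box_bump (bigD1 i)//=.
suff -> : bump_poly 1 (m.+1%:R * (x ord0 i - p.1 ord0 i)) *
  bump_poly 1 (m.+1%:R * (p.2 ord0 i - x ord0 i)) = 0 :> R by rewrite mul0r.
case/orP: H => H.
  rewrite [X in X * _]bump_poly1_eq0 ?mul0r//.
  by rewrite mulr_ge0_le0// subr_le0 ltW.
rewrite [X in _ * X]bump_poly1_eq0 ?mulr0//.
by rewrite mulr_ge0_le0// subr_le0 ltW.
Qed.

Lemma box_bump_cvg p x : oobox p x -> box_bump p m x @[m --> \oo] --> (1 : R).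
Proof.
move=> px; rewrite (_ : 1 = \prod_(i < n.+1) (((0 < x ord0 i - p.1 ord0 i)%R)%:R *
    ((0 < p.2 ord0 i - x ord0 i)%R)%:R)).
  by apply: cvg_prodr => i; apply: cvgM; exact: bump_poly1_cvg.
rewrite big1// => i _; have /andP[px1 px2] := px i.
by rewrite !subr_gt0 px1 px2 mulr1.
Qed.

Lemma obox_bump_cvg p x : obox_bump p m x @[m --> \oo] --> (\1_(obox p) x : R).
Proof.
rewrite (_ : \1_(obox p) x = \prod_(i < n.+1)
    (((0 < x ord0 i - p.1 ord0 i)%R)%:R * (1 - ((0 < x ord0 i - p.2 ord0 i)%R)%:R))).
  apply: cvg_prodr => i; apply: cvgM; first exact: bump_poly1_cvg.
  by apply: cvgB; [exact: cvg_cst|exact: bump_poly1_cvg].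
rewrite indicE; case: (boolP (x \in obox p)) => [|/negP]; rewrite inE => px.
  rewrite big1// => i _; have /andP[px1 px2] := px i.
  by rewrite !subr_gt0 px1 ltNge px2 subr0 mulr1.
have /existsNP[i /negP] := px.
rewrite negb_and -leNgt -ltNge (bigD1 i)//= !subr_gt0.
move=> /orP[px1|px2]; first by rewrite [p.1 _ _ < _]ltNge px1 !mul0r.
by rewrite px2 subrr mulr0 mul0r.
Qed.

End test_functions.

(** * The fundamental lemma of the calculus of variations *)

Section fundamental_lemma.
Context {R : realType} {n : nat}.
Local Notation V := 'rV[R]_n.+1.
Local Notation mu := (@lebesgueN R n).
Variable Omega : set V.
Hypothesis oO : open Omega.
Hypothesis bO : bounded_set Omega.
Let mO : measurable (Omega : set (Rn R n)) := measurable_open oO.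
Let Ofin : (mu Omega < +oo)%E := bounded_lebesgueN_fin bO.
Local Notation L2 := (L2 Omega).
Local Notation L2dot := (L2dot Omega).
Local Notation L2norm := (L2norm Omega).

Lemma measurable_indicO (E : set V) : measurable (E : set (Rn R n)) ->
  measurable_fun (Omega : set (Rn R n)) (\1_E : Rn R n -> R).
Proof. by move=> mE; exact: measurable_funTS. Qed.

Lemma prodrC_itv01 I (r : seq I) (F : I -> R) : (forall i, 0 <= F i <= 1) ->
  `|1 - \prod_(i <- r) (1 - F i)| <= 1.
Proof.
move=> F01; have /andP[? ?] : 0 <= \prod_(i <- r) (1 - F i) <= 1.
  by apply: prodr_itv01 => i; have /andP[? ?] := F01 i; apply/andP; split; lra.
by rewrite ger0_norm; lra.
Qed.

(** 1 - prod (1 - bump_k) is a smooth union of bumps: over the first m boxes its support is a finite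
    union of closed boxes in [Omega]. Once m > k0, its distance to 1 is at most that of the single
    bump of box k0, which tends to 0 on that open box. *)
Lemma cutoff_exists : exists zeta : nat -> V -> R,
  [/\ forall m, test_fun Omega (zeta m), forall m x, `|zeta m x| <= 1 &
    forall x, Omega x -> zeta m x @[m --> \oo] --> (1 : R)].
Proof.
have [C [CO OC]] := open_box_cover oO.
exists (fun m x => 1 - \prod_(k <- iota 0 m) (1 - box_bump (C k) m x)); split.
- move=> m; split.
    apply: smoothB; first exact: smooth_cst.
    apply: smooth_prod => k; apply: smoothB; first exact: smooth_cst.
    exact: smooth_box_bump.
  exists (\big[setU/set0]_(k <- iota 0 m) cbox (C k)); split.
  + by apply: bigsetU_compact => k _; exact: compact_cbox.
  + by rewrite -bigcup_seq; apply: bigcup_sub => k _; exact: CO.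
  + move=> x; rewrite -bigcup_seq => /= xC; rewrite big_seq big1 ?subrr// => k km.
    by rewrite box_bump_eq0 ?subr0// => Ckx; apply: xC; exists k.
- by move=> m x; apply: prodrC_itv01 => k; exact: box_bump_itv.
- move=> x /OC[k0 Ck0]; rewrite -[X in _ --> X]subr0.
  apply: cvgB; first exact: cvg_cst.
  apply: (@squeeze_cvgr _ _ _ _ (fun=> 0) (fun m => 1 - box_bump (C k0) m x)).
  + near=> m; have b01 k : 0 <= 1 - box_bump (C k) m x <= 1.
      by have /andP[? ?] := box_bump_itv (C k) m x; apply/andP; split; lra.
    have /andP[-> _] := prodr_itv01 (iota 0 m) b01; rewrite /=.
    rewrite (big_rem k0)/=; last by rewrite mem_iota; near: m; exact: nbhs_infty_gt.
    rewrite -[leRHS]mulr1; have /andP[? _] := b01 k0.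
    by rewrite ler_wpM2l//; have /andP[] := prodr_itv01 (rem k0 (iota 0 m)) b01.
  + exact: cvg_cst.
  + rewrite -[X in _ --> X](subrr 1).
    by apply: cvgB; [exact: cvg_cst|exact: box_bump_cvg].
Unshelve. all: by end_near. Qed.

Variable G : V -> R.
Hypothesis LG : L2 G.
Hypothesis G_orth : forall chi, test_fun Omega chi -> L2dot G chi = 0.

(** Three limits in turn: smooth bumps become the indicator [w K] of the first K boxes, against a
    test function; K tends to infinity; then the cutoffs [zeta m] tend to 1 and remove the test
    function. *)
Lemma orth_obox_union (C : nat -> V * V) :
  L2dot G (\1_(\bigcup_k obox (C k))) = 0.
Proof.
set U := \bigcup_k _.
have mU : measurable (U : set (Rn R n)).
  by apply: bigcup_measurable => k _; exact: measurable_obox.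
pose w K x : R := 1 - \prod_(k <- iota 0 K) (1 - \1_(obox (C k)) x).
have w_le1 K x : `|w K x| <= 1.
  by apply: prodrC_itv01 => k; rewrite indicE; case: (_ \in _); rewrite /= ?lexx ?ler01.
have mw K : measurable_fun (Omega : set (Rn R n)) (w K : Rn R n -> R).
  apply: measurable_funB; first exact: measurable_cst.
  apply: measurable_prod => k _; apply: measurable_funB; first exact: measurable_cst.
  by apply: measurable_indicO; exact: measurable_obox.
have wchi K chi : test_fun Omega chi -> L2dot G (fun x => w K x * chi x) = 0.
  move=> tchi; have [D D0 chiD] := test_bounded tchi.
  pose F m x : R := (1 - \prod_(k <- iota 0 K) (1 - obox_bump (C k) m x)).
  have sF m : smooth (F m).
    apply: smoothB; first exact: smooth_cst.
    apply: smooth_prod => k; apply: smoothB; first exact: smooth_cst.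
    exact: smooth_obox_bump.
  have FG : L2dot G (fun x => F m x * chi x) @[m --> \oo] -->
      L2dot G (fun x => w K x * chi x).
    apply: (L2dot_dct oO bO (C := D) LG) => [m|m x Ox|x Ox].
    - by apply: test_measurable => //; exact: test_smoothM.
    - rewrite normrM -[leRHS]mul1r ler_pM//.
      by apply: prodrC_itv01 => k; exact: obox_bump_itv.
    - apply: cvgMl; apply: cvgB; first exact: cvg_cst.
      apply: cvg_prodr => k; apply: cvgB; first exact: cvg_cst.
      exact: obox_bump_cvg.
  apply/esym; apply: (cvg_unique _ _ FG); first exact: norm_hausdorff.
  rewrite (_ : (fun m => _) = fun=> 0); first exact: cvg_cst.
  by apply/funext => m; apply: G_orth; exact: test_smoothM.
have [zeta [tz z1 zcvg]] := cutoff_exists.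
have Uchi m : L2dot G (fun x => \1_U x * zeta m x) = 0.
  have FG : L2dot G (fun x => w K x * zeta m x) @[K --> \oo] -->
      L2dot G (fun x => \1_U x * zeta m x).
    apply: (L2dot_dct oO bO (C := 1) LG) => [K|K x Ox|x Ox].
    - by apply: measurable_funM => //; exact: test_measurable.
    - by rewrite normrM mulr_ile1.
    - apply: cvgMl; rewrite indicE; case: (boolP (x \in U)) => [|/negP]; rewrite inE => xU.
        have [k _ Ck] := xU; apply: cvg_near_cst; near=> K.
        rewrite /w (big_rem k)/=; last by rewrite mem_iota; near: K; exact: nbhs_infty_gt.
        by rewrite indicE mem_set// subrr mul0r subr0.
      rewrite (_ : w ^~ x = fun=> 0); first exact: cvg_cst.
      apply/funext => K; rewrite /w big1 ?subrr// => k _.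
      by rewrite indicE memNset ?subr0// => Ck; apply: xU; exists k.
  apply/esym; apply: (cvg_unique _ _ FG); first exact: norm_hausdorff.
  rewrite (_ : (fun K => _) = fun=> 0); first exact: cvg_cst.
  by apply/funext => K; exact: wchi.
have FG : L2dot G (fun x => \1_U x * zeta m x) @[m --> \oo] --> L2dot G (\1_U).
  apply: (L2dot_dct oO bO (C := 1) LG) => [m|m x Ox|x Ox].
  - by apply: measurable_funM; [exact: measurable_indicO|exact: test_measurable].
  - by rewrite normrM mulr_ile1// indicE; case: (_ \in _); rewrite ?normr1 ?normr0.
  - by rewrite -[X in _ --> X]mulr1; apply: cvgMr; exact: zcvg.
apply/esym; apply: (cvg_unique _ _ FG); first exact: norm_hausdorff.
rewrite (_ : (fun m => _) = fun=> 0); first exact: cvg_cst.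
by apply/funext => m; exact: Uchi.
Unshelve. all: by end_near. Qed.

Lemma L2_indic (E : set V) : measurable (E : set (Rn R n)) -> L2 (\1_E).
Proof.
move=> mE; apply: (L2_bounded mO Ofin (C := 1)); first exact: measurable_indicO.
by move=> x _; rewrite indicE; case: (_ \in _); rewrite ?normr1 ?normr0.
Qed.

(* E is approximated from outside by a countable union of boxes. *)
Lemma orth_indic (E : set V) : measurable (E : set (Rn R n)) -> E `<=` Omega ->
  L2dot G (\1_E) = 0.
Proof.
move=> mE EO; apply/eqP; rewrite -normr_le0; apply/ler_addgt0Pr => e e0.
rewrite add0r.
pose N := L2norm G + 1; have N0 : 0 < N by rewrite ltr_wpDl// L2norm_ge0.
(* Since [G] is orthogonal to the indicator of the cover U, only U minus E contributes; by
   Cauchy-Schwarz this is at most N sqrt(eps) = e. The 1 added in N keeps it positive. *)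
pose eps := (e / N) ^+ 2; have eps0 : 0 < eps by rewrite exprn_gt0// divr_gt0.
have muE : mu E \is a fin_num.
  by rewrite ge0_fin_numE//; apply: le_lt_trans Ofin; exact: le_lebesgueN.
have [_ [C CE <-] Csum] := lb_ereal_inf_adherent eps0 muE.
set U := \bigcup_k obox (C k).
have mU : measurable (U : set (Rn R n)).
  by apply: bigcup_measurable => k _; exact: measurable_obox.
have mUE : measurable (U `\` E : set (Rn R n)) by exact: measurableD.
have UE : (mu (U `\` E) <= eps%:E)%E.
  have : (mu U < mu E + eps%:E)%E.
    by apply: le_lt_trans Csum; apply: ereal_inf_lbound; exists C.
  have -> : mu U = (mu E + mu (U `\` E))%E.
    by rewrite -measureU//; [rewrite setDUK|rewrite setDIK].
  by rewrite lteD2lE// => /ltW.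
have -> : L2dot G (\1_E) = - L2dot G (\1_(U `\` E)).
  apply/eqP; rewrite -subr_eq0 opprK -(L2dotDr mO)//; [|exact: L2_indic..].
  rewrite -[X in _ == X](orth_obox_union C) -/U; apply/eqP; apply: eq_Rintegral => x _.
  congr (_ * _); rewrite !indicE in_setD.
  case: (boolP (x \in E)) => [xE|_] /=; last by rewrite add0r andbT.
  by rewrite andbF addr0 mem_set//; apply: CE; exact/set_mem.
rewrite normrN; apply: (le_trans (L2_CS mO LG (L2_indic mUE))).
have -> : e = N * (e / N) by field; rewrite gt_eqF.
apply: ler_pM; rewrite ?L2norm_ge0 ?lerDl//.
have -> : e / N = Num.sqrt eps by rewrite sqrtr_sqr ger0_norm// divr_ge0// ltW.
rewrite ler_wsqrtr//.
rewrite -lee_fin; apply: le_trans UE.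
have -> : L2dot (\1_(U `\` E)) (\1_(U `\` E)) =
    \int[mu]_(x in Omega) \1_(U `\` E : set (Rn R n)) x.
  by apply: eq_Rintegral => x _; rewrite indicE; case: (_ \in _); rewrite ?mulr1 ?mulr0.
rewrite /Rintegral integral_indic// fineK; last first.
  rewrite ge0_fin_numE//; apply: le_lt_trans Ofin; apply: le_lebesgueN.
  exact: subIsetr.
by apply: le_lebesgueN; exact: subIsetl.
Qed.

(** By [orth_indic] the integral of [G] over every measurable subset of [Omega] vanishes. *)
Lemma orth_test_ae_eq0 : ae_eq mu (Omega : set (Rn R n)) (G : Rn R n -> R) (fun=> 0).
Proof.
have iG : mu.-integrable Omega (EFin \o (G : Rn R n -> R)).
  have L1 : L2 (fun=> 1) by exact: L2_cst.
  by apply: eq_integrable (L2M_integrable mO LG L1) => // x _ /=; rewrite mulr1.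
have H : ae_eq mu (Omega : set (Rn R n)) (EFin \o (G : Rn R n -> R)) (EFin \o (fun=> 0)).
  apply: integral_ae_eq => //; first exact/measurable_EFinP/measurable_cst.
  move=> E EO mE; rewrite [RHS]integral0_eq//.
  have iGE : mu.-integrable E (EFin \o (G : Rn R n -> R)) by exact: integrableS iG.
  have E0 : \int[mu]_(x in E) (G : Rn R n -> R) x = 0.
    rewrite -(orth_indic mE EO) -[in LHS](setIidr EO) Rintegral_mkcondr.
    apply: eq_Rintegral => x _; rewrite patchE indicE.
    by case: (x \in E); rewrite ?mulr1 ?mulr0.
  transitivity ((\int[mu]_(x in E) (G : Rn R n -> R) x)%:E); last by rewrite E0.
  by rewrite /Rintegral fineK//; exact: integrable_fin_num.
by apply: filterS H => x Hx Ox; have [] := Hx Ox.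
Qed.

End fundamental_lemma.

Lemma orth_test_eq0 (R : realType) (n : nat) (Omega : set 'rV[R]_n.+1) G h :
  open Omega -> bounded_set Omega -> L2 Omega G -> L2 Omega h ->
  (forall chi, test_fun Omega chi -> L2dot Omega G chi = 0) ->
  L2dot Omega G h = 0.
Proof.
move=> oO bO LG Lh G0.
by rewrite (L2dot_ae (measurable_open oO) (orth_test_ae_eq0 oO bO LG G0)) ?L2dot0l.
Qed.

(** * Mollification *)

Section compact_support.
Context {R : realType} {n : nat}.
Local Notation V := 'rV[R]_n.+1.
Local Notation mu := (@lebesgueN R n).

(** The near-covering form of compactness, with the filter of radii tending to 0 from the right.
    Monotonicity passes from one local radius to all smaller ones. *)
Lemma compact_uniform_radius (K : set V) (P : R -> V -> Prop) : compact K ->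
  (forall r s x, 0 < s <= r -> P r x -> P s x) ->
  (forall x, K x -> exists2 r : R, 0 < r & forall y, `|x - y| < r -> P r y) ->
  exists2 r : R, 0 < r & forall x, K x -> P r x.
Proof.
move=> /compact_near_coveringP cK Pmono Ploc.
have [|d /= d0 HK] := cK R (0^'+) P _.
  move=> x /Ploc[r r0 Hr]; exists ([set y | `|x - y| < r], [set s | 0 < s <= r]) => /=.
    split; first by apply/nbhs_ballP; exists r => //= y; rewrite mx_norm_ball.
    exists r => //= s; rewrite /ball_/= sub0r normrN => sr s0.
    by rewrite s0/= ltW// (le_lt_trans _ sr)// ler_norm.
  by move=> [y s] [/= yr /Pmono]; apply; exact: Hr.
exists (d / 2) => [|x Kx]; first by rewrite divr_gt0.
apply: HK => //=; last by rewrite divr_gt0.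
by rewrite /ball_/= sub0r normrN gtr0_norm ?divr_gt0//; lra.
Qed.

(** The estimate is symmetric in x and y, so it suffices that one of them lies in [K]; otherwise
    both values are 0. *)
Lemma compact_support_uniform (f : V -> R) (K : set V) (e : R) : compact K ->
  continuous f -> (forall x, ~ K x -> f x = 0) -> 0 < e ->
  exists2 r : R, 0 < r & forall x y, `|x - y| < r -> `|f x - f y| < e.
Proof.
move=> cK cf f0 e0.
have [||r r0 Hr] := @compact_uniform_radius K
    (fun r x => forall y, `|x - y| < r -> `|f x - f y| < e) cK.
- by move=> r s x /andP[_ sr] H y xy; apply: H; exact: lt_le_trans sr.
- move=> x _; have /cvgrPdist_lt/(_ (e / 2)) := cf x.
  rewrite divr_gt0// => /(_ isT) /nbhs_ballP[r /= r0 xr].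
  exists (r / 2); first by rewrite divr_gt0.
  have Hr y : `|x - y| < r -> `|f x - f y| < e / 2.
    by move=> xy; apply: xr; rewrite mx_norm_ball.
  move=> y xy z yz; rewrite -(subrKA (f x)).
  have fxz : `|f x - f z| < e / 2.
    by apply: Hr; rewrite -(subrKA y) (le_lt_trans (ler_normD _ _))//; lra.
  have fxy : `|f x - f y| < e / 2 by apply: Hr; lra.
  by rewrite (le_lt_trans (ler_normD _ _))// (distrC (f y)); lra.
exists r => // x y xy; have [Kx|nKx] := pselect (K x); first exact: Hr.
have [Ky|nKy] := pselect (K y).
  by rewrite distrC; apply: Hr => //; rewrite distrC.
by rewrite !f0// subrr normr0.
Qed.

Lemma compact_measurableN (K : set V) : compact K -> measurable (K : set (Rn R n)).
Proof. by move=> cK; apply: measurable_closed; exact: compact_closedN. Qed.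

Lemma compact_lebesgueN_fin (K : set V) : compact K -> (mu K < +oo)%E.
Proof. by move/compact_bounded/bounded_lebesgueN_fin. Qed.

Lemma compact_support_integrable (f : V -> R) (K : set V) (C : R) : compact K ->
  measurable_fun setT (f : Rn R n -> R) -> (forall x, `|f x| <= C) ->
  (forall x, ~ K x -> f x = 0) -> mu.-integrable setT (EFin \o (f : Rn R n -> R)).
Proof.
move=> cK mf fC f0; have mK := compact_measurableN cK.
have -> : EFin \o (f : Rn R n -> R) = ((EFin \o (f : Rn R n -> R)) \_ K)%E.
  apply/funext => x; rewrite patchE; case: ifPn => // /negP; rewrite inE.
  by move=> /f0 /= ->.
apply/(integrable_mkcond _ mK); apply: measurable_bounded_integrable => //.
- exact: compact_lebesgueN_fin.
- exact: measurable_funTS.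
- by exists C; split; [exact: num_real|move=> M CM x _; apply: le_trans (fC x) (ltW CM)].
Qed.

(** The compactly supported weight [W] makes C' |W| an integrable majorant of the t-derivative. The
    map [phi] is y -> x - y for derivatives of convolutions falling on the kernel and the identity
    in the other uses. *)
Lemma is_derive_under_shift (W rho : V -> R) (phi : V -> V) (v : V) (K : set V)
    (CW C C' : R) :
  compact K -> measurable_fun setT (W : Rn R n -> R) -> (forall x, `|W x| <= CW) ->
  (forall x, ~ K x -> W x = 0) ->
  continuous rho -> (forall x, `|rho x| <= C) -> (forall x, derivable rho x v) ->
  (forall x, `|'D_v rho x| <= C') -> continuous phi ->
  is_derive (0 : R) 1 (fun t => \int[mu]_y (W y * rho (phi y + t *: v)))
    (\int[mu]_y (W y * 'D_v rho (phi y))).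
Proof.
move=> cK mW WC W0 crho rhoC drho drhoC cphi.
have C'0 : 0 <= C' by apply: le_trans (drhoC 0).
pose f (t : R) (y : Rn R n) := W y * rho (phi y + t *: v).
have Df t y : 'D_1 (f^~ y) t = W y * 'D_v rho (phi y + t *: v).
  rewrite -(derive_line rho (phi y) v t).
  by apply: deriveZ; rewrite derivable_line.
have intf t : mu.-integrable setT (EFin \o f t).
  apply: (@compact_support_integrable _ K (CW * C) cK).
  - apply: (measurable_funM mW).
    apply: (@continuous_measurableN _ _ (fun y => rho (phi y + t *: v))) => y. apply: (@continuous_comp _ _ _ (fun y => phi y + t *: v) rho); last exact: crho.
    by apply: continuousD; [exact: cphi|exact: cst_continuous].
  - by move=> y; rewrite /f normrM ler_pM.
  - by move=> y /W0; rewrite /f => ->; rewrite mul0r.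
have dff t y : derivable (f^~ y) t 1.
  by rewrite /f; apply: derivableM; [exact: derivable_cst|rewrite derivable_line].
pose G (y : Rn R n) := C' * `|W y|.
have iG : mu.-integrable setT (EFin \o G).
  apply: (@compact_support_integrable _ K (C' * CW) cK).
  - apply: measurable_funM; first exact: measurable_cst.
    exact: measurableT_comp.
  - by move=> y; rewrite /G normrM normr_id ger0_norm// ler_wpM2l.
  - by move=> y /W0; rewrite /G => ->; rewrite normr0 mulr0.
have I0 : `]-1, 1[%classic (0 : R) by rewrite /= in_itv/= ltrN10 ltr01.
have Gub t y : `]-1, 1[%classic t -> setT y -> `|partial1of2 f t y| <= G y.
  move=> _ _; rewrite partial1of2E Df normrM /G mulrC; exact: ler_wpM2r.
have H1 := @derivable_under_integral R _ (Rn R n) mu f setT measurableT 0 (-1) 1 I0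
  (fun t _ => intf t) (fun t y _ _ => dff t y) G (fun y => mulr_ge0 C'0 (normr_ge0 _))
  iG Gub.
have H2 := @differentiation_under_integral R _ (Rn R n) mu f setT measurableT 0 (-1) 1 I0
  (fun t _ => intf t) (fun t y _ _ => dff t y) G (fun y => mulr_ge0 C'0 (normr_ge0 _))
  iG Gub.
apply: DeriveDef; first exact: H1.
rewrite -derive1E H2; apply: eq_Rintegral => y _.
by rewrite partial1of2E Df scale0r addr0.
Qed.

(* By translation invariance the integral of F (x + t v) is constant in t. *)
Lemma Rintegral_derive0 (F : V -> R) (K : set V) (v : V) : compact K ->
  (forall x, ~ K x -> F x = 0) -> continuous F -> (forall x, derivable F x v) ->
  continuous ('D_v F) -> \int[mu]_x 'D_v F x = 0.
Proof.
move=> cK F0 cF dF cDF.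
have [C C0 FC] := compact_support_bounded cK cF F0.
have DF0 x : ~ K x -> 'D_v F x = 0.
  by move=> Kx; have [] := derive_off_support v cK F0 Kx.
have [C' C'0 DFC] := compact_support_bounded cK cDF DF0.
have [M [_ /(_ (`|M| + 1)) HM]] := compact_bounded cK.
have {}HM x : K x -> `|x| <= `|M| + 1.
  by move=> Kx; apply: HM => //; have := ler_norm M; lra.
(* The cube [L] contains every translate of [K] by - t v with |t| <= 1. Inserting its indicator as
   the weight therefore does not change the integrals for these t. *)
pose N := `|M| + 1 + `|v|.
have N0 : 0 <= N by rewrite !addr_ge0.
pose L : set V := cbox (const_mx (- N), const_mx N).
have cL : compact L by exact: compact_cbox.
have KL t x : `|t| <= 1 -> K (x + t *: v) -> L x.
  move=> t1 /HM xt i; rewrite /= !mxE -ler_norml; apply: le_trans (rV_coord_le x i) _.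
  rewrite -[x](addrK (t *: v)) (le_trans (ler_normB _ _))// lerD// normrZ.
  by rewrite -[leRHS]mul1r ler_wpM2r.
have H := @is_derive_under_shift (\1_L) F id v L 1 C C' cL.
have {}H : is_derive (0 : R) 1 (fun t => \int[mu]_y (\1_L y * F (y + t *: v)))
    (\int[mu]_y (\1_L y * 'D_v F y)).
  apply: (H _ _ _ cF FC dF DFC).
  - by apply: measurable_indic; exact: compact_measurableN.
  - by move=> x; rewrite indicE; case: (_ \in _); rewrite ?normr1 ?normr0.
  - by move=> x Lx; rewrite indicE memNset.
  - by move=> x; exact: cvg_id.
have near_cst : \forall t \near (0 : R),
    \int[mu]_y (\1_L y * F (y + t *: v)) = (cst (\int[mu]_y F y)) t.
  near=> t; have t1 : `|t| <= 1.
    by near: t; apply/nbhs_ballP; exists 1 => //= t; rewrite /ball/= sub0r normrN => /ltW.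
  have iF : mu.-integrable setT (EFin \o (F : Rn R n -> R)).
    by apply: (compact_support_integrable cK) => //; exact: continuous_measurableN.
  have [_ <-] := Rintegral_shift (t *: v) iF.
  apply: eq_Rintegral => x _; rewrite indicE.
  case: (boolP (x \in L)) => [_|/negP xL]; first by rewrite mul1r.
  rewrite mul0r F0// => Kx; apply: xL; rewrite inE; exact: KL Kx.
have := near_eq_is_derive near_cst H => -[_].
rewrite derive_cst => H0; rewrite [RHS]H0; apply: eq_Rintegral => x _.
rewrite indicE; case: (boolP (x \in L)) => [_|/negP xL]; first by rewrite mul1r.
rewrite mul0r DF0// => Kx; apply: xL; rewrite inE; apply: (KL 0); first by rewrite normr0.
by rewrite scale0r addr0.
Unshelve. all: by end_near. Qed.

End compact_support.

Section mollification.
Context {R : realType} {n : nat}.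
Local Notation V := 'rV[R]_n.+1.
Local Notation mu := (@lebesgueN R n).
Implicit Types (F rho : V -> R) (K L : set V).

Definition conv F rho (x : V) : R := \int[mu]_y (F y * rho (x - y)).

Let subl_continuous (x : V) : continuous (fun y : V => x - y).
Proof. by move=> y; apply: continuousB; [exact: cst_continuous|exact: cvg_id]. Qed.

Lemma continuous_subl rho (x : V) : continuous rho -> continuous (fun y : V => rho (x - y)).
Proof.
move=> crho y; apply: (@continuous_comp V V R (fun y : V => x - y) rho); last exact: crho.
exact: subl_continuous.
Qed.

Lemma conv_integrable F rho K C D x : compact K -> continuous F ->
  (forall y, ~ K y -> F y = 0) -> (forall y, `|F y| <= C) ->
  continuous rho -> (forall y, `|rho y| <= D) ->
  mu.-integrable setT (EFin \o ((fun y => F y * rho (x - y)) : Rn R n -> R)).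
Proof.
move=> cK cF F0 FC crho rhoD.
apply: (@compact_support_integrable _ _ _ K (C * D) cK).
- apply: continuous_measurableN => y.
  by apply: continuousM; [exact: cF|exact: continuous_subl].
- by move=> y; rewrite normrM ler_pM.
- by move=> y /F0 ->; rewrite mul0r.
Qed.

Lemma conv_continuous F rho K L : compact K -> continuous F ->
  (forall y, ~ K y -> F y = 0) -> compact L -> continuous rho ->
  (forall y, ~ L y -> rho y = 0) -> continuous (conv F rho).
Proof.
move=> cK cF F0 cL crho rho0 x.
have [C C0 FC] := compact_support_bounded cK cF F0.
have [D D0 rhoD] := compact_support_bounded cL crho rho0.
have iaF : mu.-integrable setT (EFin \o ((fun y => `|F y|) : Rn R n -> R)).
  apply: (@compact_support_integrable _ _ _ K C cK).
  - by apply: measurableT_comp => //; exact: continuous_measurableN.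
  - by move=> y; rewrite normr_id.
  - by move=> y /F0 ->; rewrite normr0.
pose I := \int[mu]_y `|F y|; have I0 : 0 <= I by exact: Rintegral_ge0.
apply: (iffRL (@cvgrPdist_lt _ _ _ (nbhs x) _ _ _)) => /= e e0.
have e'0 : 0 < e / (I + 1) by rewrite divr_gt0// ltr_wpDl.
have [r r0 Hr] := compact_support_uniform cL crho rho0 e'0.
apply/nbhs_ballP; exists r => //= z; rewrite mx_norm_ball /ball_/= => xz.
have iF w := conv_integrable w cK cF F0 FC crho rhoD.
rewrite /conv -RintegralB//.
apply: (@le_lt_trans _ _ (\int[mu]_y (e / (I + 1) * `|F y|))).
  apply: le_trans (le_normr_Rintegral _ _) _ => //.
    exact: integrableB (iF x) (iF z).
  apply: le_Rintegral => //.
  - exact: (integrable_norm (integrableB measurableT (iF x) (iF z))).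
  - exact: (integrableZl measurableT _ iaF).
  - move=> y _; rewrite -mulrBr normrM mulrC ler_wpM2r// ltW//.
    by apply: Hr; rewrite opprB addrA subrK.
rewrite RintegralZl// -/I -mulrA -[ltRHS]mulr1 ltr_pM2l//.
by rewrite mulrC ltr_pdivrMr ?mul1r ?ltrDl// ltr_wpDl.
Qed.

(* Differentiating rho shows that the convolution is smooth; differentiating F
   (conv_is_deriver) gives the convergence of its derivatives. *)
Lemma conv_is_derivel F rho K L (v x : V) : compact K -> continuous F ->
  (forall y, ~ K y -> F y = 0) -> compact L -> continuous rho ->
  (forall y, ~ L y -> rho y = 0) -> (forall y, derivable rho y v) ->
  continuous ('D_v rho) ->
  is_derive x v (conv F rho) (conv F ('D_v rho) x).
Proof.
move=> cK cF F0 cL crho rho0 drho cDrho.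
have [C C0 FC] := compact_support_bounded cK cF F0.
have [D D0 rhoD] := compact_support_bounded cL crho rho0.
have Drho0 y : ~ L y -> 'D_v rho y = 0.
  by move=> Ly; have [] := derive_off_support v cL rho0 Ly.
have [D' D'0 DrhoD] := compact_support_bounded cL cDrho Drho0.
rewrite -[X in is_derive X _ _ _]addr0 -(scale0r v); apply/is_derive_line.
rewrite (_ : (fun s => _) =
    fun t : R => \int[mu]_y (F y * rho ((fun y => x - y) y + t *: v))).
  apply: (is_derive_under_shift cK _ FC F0 crho rhoD drho DrhoD).
    exact: continuous_measurableN.
  exact: subl_continuous.
by apply/funext => t; apply: eq_Rintegral => y _; rewrite addrAC.
Qed.

Lemma conv_smooth F rho K L : compact K -> continuous F ->
  (forall y, ~ K y -> F y = 0) -> compact L -> smooth rho ->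
  (forall y, ~ L y -> rho y = 0) -> smooth (conv F rho).
Proof.
move=> cK cF F0 cL + + k; elim: k rho => [|k IH] rho srho rho0.
  by split=> //; apply: (conv_continuous cK cF F0 cL) => //; exact: smooth_continuous.
split.
  by apply: (conv_continuous cK cF F0 cL) => //; exact: smooth_continuous.
move=> i; have H x := conv_is_derivel x cK cF F0 cL (smooth_continuous srho) rho0
  (fun y => @smooth_derivable _ _ rho i y srho) (smooth_continuous (smooth_derive i srho)).
split; first by move=> x; case: (H x).
have -> : 'D_(basis_vec i) (conv F rho) = conv F ('D_(basis_vec i) rho).
  by apply/funext => x; case: (H x).
apply: IH; first exact: smooth_derive.
by move=> y Ly; have [] := derive_off_support (basis_vec i) cL rho0 Ly.
Qed.

(** Translating the integration variable by t v moves the shift from [rho] to [F]; y -> rho (x - y)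
    then acts as the fixed weight. *)
Lemma conv_is_deriver F rho K L (v x : V) : compact K -> continuous F ->
  (forall y, ~ K y -> F y = 0) -> (forall y, derivable F y v) ->
  continuous ('D_v F) -> compact L -> continuous rho ->
  (forall y, ~ L y -> rho y = 0) ->
  is_derive x v (conv F rho) (conv ('D_v F) rho x).
Proof.
move=> cK cF F0 dF cDF cL crho rho0.
have [C C0 FC] := compact_support_bounded cK cF F0.
have [D D0 rhoD] := compact_support_bounded cL crho rho0.
have DF0 y : ~ K y -> 'D_v F y = 0.
  by move=> Ky; have [] := derive_off_support v cK F0 Ky.
have [C' C'0 DFC] := compact_support_bounded cK cDF DF0.
rewrite -[X in is_derive X _ _ _]addr0 -(scale0r v); apply/is_derive_line.
pose W y := rho (x - y).
rewrite (_ : (fun s => _) = fun t : R => \int[mu]_y (W y * F (id y + t *: v))).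
  rewrite (_ : conv _ _ _ = \int[mu]_y (W y * 'D_v F (id y))); last first.
    by apply: eq_Rintegral => y _; rewrite mulrC.
  pose L' : set V := (fun y => x - y) @` L.
  have cL' : compact L'.
    apply: continuous_compact => //; apply: continuous_subspaceT.
    exact: subl_continuous.
  apply: (@is_derive_under_shift _ _ W F id v L' D C C') => //.
  - by apply: continuous_measurableN; exact: continuous_subl.
  - by move=> y; exact: rhoD.
  - move=> y L'y; apply: rho0 => Ly; apply: L'y; exists (x - y) => //=.
    by rewrite opprB addrCA subrr addr0.
  - by move=> y; exact: cvg_id.
apply/funext => t; rewrite /conv.
have [_ <-] := Rintegral_shift (t *: v)
  (conv_integrable (x + t *: v) cK cF F0 FC crho rhoD).
apply: eq_Rintegral => y _ /=; rewrite mulrC /W; congr (rho _ * _).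
by rewrite opprD addrACA subrr addr0.
Qed.

(** The mass of the kernel is the same at every x, by translation. It is kept as the integral of rho
    (- y), which spares the invariance under reflections. *)
Lemma Rintegral_subl rho L x : compact L -> continuous rho ->
  (forall y, ~ L y -> rho y = 0) ->
  mu.-integrable setT (EFin \o ((fun y => rho (x - y)) : Rn R n -> R)) /\
  \int[mu]_y rho (x - y) = \int[mu]_y rho (- y).
Proof.
move=> cL crho rho0.
have [D D0 rhoD] := compact_support_bounded cL crho rho0.
have iN z : mu.-integrable setT (EFin \o ((fun y => rho (z - y)) : Rn R n -> R)).
  pose L' : set V := (fun y => z - y) @` L.
  have cL' : compact L'.
    apply: continuous_compact => //; apply: continuous_subspaceT.
    exact: subl_continuous.
  apply: (@compact_support_integrable _ _ _ L' D cL').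
  - by apply: continuous_measurableN; exact: continuous_subl.
  - by move=> y; exact: rhoD.
  move=> y L'y; apply: rho0 => Ly; apply: L'y; exists (z - y) => //=.
  by rewrite opprB addrCA subrr addr0.
split=> //; have [_ <-] := Rintegral_shift x (iN x).
by apply: eq_Rintegral => y _ /=; rewrite opprD addrCA subrr addr0.
Qed.

(** The kernel is not normalized, so the comparison is with its mass times F x. Only points y with
    |x - y| <= r contribute, and there [F] varies by at most e. *)
Lemma conv_approx F rho K L x (r e : R) : compact K -> continuous F ->
  (forall y, ~ K y -> F y = 0) -> compact L -> continuous rho ->
  (forall y, ~ L y -> rho y = 0) -> (forall y, 0 <= rho y) ->
  (forall y, L y -> `|y| <= r) ->
  (forall y, `|x - y| <= r -> `|F x - F y| <= e) ->
  `|conv F rho x - (\int[mu]_y rho (- y)) * F x| <= e * \int[mu]_y rho (- y).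
Proof.
move=> cK cF F0 cL crho rho0 rho_ge0 Lr Fe.
have [C C0 FC] := compact_support_bounded cK cF F0.
have [D D0 rhoD] := compact_support_bounded cL crho rho0.
have [irho <-] := Rintegral_subl x cL crho rho0.
have iF := conv_integrable x cK cF F0 FC crho rhoD.
have iFx := integrableZl measurableT (F x) irho.
rewrite mulrC -!RintegralZl// /conv -RintegralB//.
apply: le_trans (le_normr_Rintegral _ _) _ => //; first exact: integrableB iF iFx.
apply: le_Rintegral => //.
- exact: (integrable_norm (integrableB measurableT iF iFx)).
- exact: (integrableZl measurableT e irho).
move=> y _; rewrite -mulrBl normrM (ger0_norm (rho_ge0 _)).
have [Ly|nLy] := pselect (L (x - y)); last by rewrite rho0// !mulr0.
by rewrite ler_wpM2r// distrC; apply: Fe; exact: Lr.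
Qed.

Lemma conv_support F rho K L x : (forall y, ~ K y -> F y = 0) ->
  (forall y, ~ L y -> rho y = 0) ->
  ~ ((fun p : V * V => p.1 + p.2) @` (K `*` L)) x -> conv F rho x = 0.
Proof.
move=> F0 rho0 xKL; rewrite /conv.
rewrite (@eq_Rintegral _ _ _ mu setT (fun=> 0)).
  by rewrite /Rintegral integral0.
move=> y _; have [Ky|/F0->] := pselect (K y); last by rewrite mul0r.
have [Ly|/rho0->] := pselect (L (x - y)); last by rewrite mulr0.
by exfalso; apply: xKL; exists (y, x - y) => //=; rewrite addrC subrK.
Qed.

End mollification.

(** * Weak derivatives and elliptic operators *)

Section weak_derivatives.
Context {R : realType} {n : nat}.
Local Notation V := 'rV[R]_n.+1.
Local Notation mu := (@lebesgueN R n).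

(* With mollifier_mass_gt0, this replaces the computation of lebesgueN on boxes. *)
Lemma lebesgueN_null_translates (A : set V) (r : R) : 0 < r ->
  mu (oobox (const_mx (- r), const_mx r)) = 0%E -> mu A = 0%E.
Proof.
move=> r0 B0; pose B : set V := oobox (const_mx (- r), const_mx r).
pose q k : V := if unpickle k is Some q then map_mx ratr (q : 'rV[rat]_n.+1) else 0.
have AB : A `<=` \bigcup_k [set x | B (x + (- q k))].
  move=> x _; have /choice[f fP] : forall i, exists q : rat,
      x ord0 i - r < (ratr q : R) < x ord0 i + r.
    move=> i; have /rat_in_itvoo[p] : x ord0 i - r < x ord0 i + r by lra.
    by rewrite in_itv/= => ?; exists p.
  exists (pickle (\row_i f i)) => // i; rewrite /q pickleK /= !mxE.
  by have /andP[? ?] := fP i; apply/andP; split; lra.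
apply/eqP; rewrite -measure_le0; apply: (le_trans (le_lebesgueN AB)).
apply: (le_trans (lebesgue_outer_sigma_subadditive _)).
by rewrite eseries0// => k _ _; rewrite lebesgue_outer_shift.
Qed.

Variable Omega : set V.
Hypothesis oO : open Omega.
Hypothesis bO : bounded_set Omega.
Let mO : measurable (Omega : set (Rn R n)) := measurable_open oO.
Let Ofin : (mu Omega < +oo)%E := bounded_lebesgueN_fin bO.
Local Notation L2 := (L2 Omega).
Local Notation L2dot := (L2dot Omega).
Local Notation L2norm := (L2norm Omega).
Local Notation is_weak_deriv := (is_weak_deriv Omega).

(** The integrand is positive on the open cube of half-side r. Were the integral 0, that cube would
    be null, and so would [Omega], since countably many translates of the cube cover it. *)
Lemma mollifier_mass_gt0 (r : R) : 0 < r -> mu Omega <> 0%E ->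
  0 < \int[mu]_y box_bump (const_mx (- r), const_mx r) 0 (- y : V).
Proof.
move=> r0 O0; set p : V * V := (const_mx (- r), const_mx r).
pose f (y : Rn R n) : R := box_bump p 0 (- y : V).
have bump0 y : ~ cbox p y -> box_bump p 0 y = 0 by exact: box_bump_eq0.
have cb : continuous (box_bump p 0).
  exact: smooth_continuous (smooth_box_bump p 0).
have [iN _] := Rintegral_subl 0 (@compact_cbox _ _ p) cb bump0.
have {}iN : mu.-integrable setT (EFin \o f).
  by apply: eq_integrable iN => // y _ /=; rewrite sub0r.
have f_ge0 y : 0 <= f y by have /andP[] := box_bump_itv p 0 (- y : V).
rewrite lt_neqAle; apply/andP; split; last by apply: Rintegral_ge0 => y _; exact: f_ge0.
apply/eqP => /esym I0.
apply: O0; apply: (@lebesgueN_null_translates Omega r r0).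
have : ae_eq mu setT (EFin \o f) (cst 0%E).
  apply: (iffLR (ae_eq_integral_abs mu measurableT (measurable_int mu iN))).
  under eq_integral do rewrite /= ger0_norm//.
  by move: I0; rewrite /Rintegral -[X in _ -> X = _]fineK ?integrable_fin_num// => ->.
move=> [N [mN N0 HN]]; apply/eqP; rewrite -measure_le0 -N0.
apply: le_lebesgueN => y yB; apply: HN => /(_ I) /= [] /eqP; rewrite gt_eqF//.
rewrite /f /box_bump; apply: prodr_gt0 => i _; have := yB i.
rewrite /= !mxE => /andP[y1 y2].
by rewrite mulr_gt0// bump_poly1_gt0// mul1r; lra.
Qed.

Lemma compact_fatten (K : set V) : compact K -> K `<=` Omega ->
  exists2 r : R, 0 < r & forall x y, K x -> `|x - y| < r -> Omega y.
Proof.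
move=> cK KO.
have [||r r0 Hr] := @compact_uniform_radius _ _ K
    (fun r x => forall y, `|x - y| < r -> Omega y) cK.
- by move=> r s x /andP[_ sr] H y xy; apply: H; exact: lt_le_trans sr.
- move=> x /KO Ox; have /nbhs_ballP[r /= r0 xr] := open_nbhs_nbhs (conj oO Ox).
  exists (r / 2) => [|y xy z yz]; first by rewrite divr_gt0.
  apply: xr; rewrite mx_norm_ball /ball_/=.
  by rewrite -(subrKA y) (le_lt_trans (ler_normD _ _))//; lra.
by exists r => // x y Kx xy; exact: Hr xy.
Qed.

(** Convolve [F] with a small bump divided by its mass c. The derivative of the convolution is the
    convolution of the derivative, so one estimate serves both. *)
Lemma mollify (F : V -> R) (K : set V) (i : 'I_n.+1) (e : R) : mu Omega <> 0%E ->
  compact K -> K `<=` Omega -> (forall x, ~ K x -> F x = 0) -> continuous F ->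
  (forall x, derivable F x (basis_vec i)) -> continuous ('D_(basis_vec i) F) ->
  0 < e ->
  exists2 chi, test_fun Omega chi & forall x, `|chi x - F x| <= e /\
    `|'D_(basis_vec i) chi x - 'D_(basis_vec i) F x| <= e.
Proof.
move=> O0 cK KO F0 cF dF cDF e0.
have DF0 x : ~ K x -> 'D_(basis_vec i) F x = 0.
  by move=> Kx; have [] := derive_off_support (basis_vec i) cK F0 Kx.
have [r1 r10 H1] := compact_support_uniform cK cF F0 e0.
have [r2 r20 H2] := compact_support_uniform cK cDF DF0 e0.
have [r3 r30 H3] := compact_fatten cK KO.
(* The three radii control the oscillation of [F], that of its derivative, and the distance from [K]
   to the complement of [Omega]. Halving makes r strictly smaller than each. *)
pose r := Num.min r1 (Num.min r2 r3) / 2.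
have r0 : 0 < r by rewrite divr_gt0// !lt_min r10 r20 r30.
have [rr1 rr2 rr3] : [/\ r < r1, r < r2 & r < r3].
  have : r < Num.min r1 (Num.min r2 r3) by rewrite ltr_pdivrMr//; rewrite /r in r0; lra.
  by rewrite !lt_min => /and3P[].
set p : V * V := (const_mx (- r), const_mx r).
have cL : compact (cbox p) by exact: compact_cbox.
pose rho := box_bump p 0.
have rho0 y : ~ cbox p y -> rho y = 0 by exact: box_bump_eq0.
have rho_ge0 y : 0 <= rho y by have /andP[] := box_bump_itv p 0 y.
have srho : smooth rho by exact: smooth_box_bump.
have crho := smooth_continuous srho.
have Lr y : cbox p y -> `|y| <= r.
  by move=> Ly; apply: rV_norm_le (ltW r0) _ => j; have := Ly j; rewrite /= !mxE ler_norml.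
pose c : R := \int[mu]_y rho (- y).
have c0 : 0 < c := mollifier_mass_gt0 r0 O0.
have approx f x : continuous f -> (forall x, ~ K x -> f x = 0) ->
    (forall y, `|x - y| <= r -> `|f x - f y| <= e) -> `|c^-1 * conv f rho x - f x| <= e.
  move=> cf f0 fe.
  have := conv_approx cK cf f0 cL crho rho0 rho_ge0 Lr fe; rewrite -/c => H.
  rewrite -(@ler_pM2r _ c)// -[X in _ * X]gtr0_norm// -normrM mulrBl mulrAC mulVf ?gt_eqF//.
  by rewrite mul1r [f x * c]mulrC.
pose KL : set V := (fun p : V * V => p.1 + p.2) @` (K `*` cbox p).
have Dconv x := conv_is_deriver x cK cF F0 dF cDF cL crho rho0.
exists (fun x => c^-1 * conv F rho x).
  split; first exact/smoothZ/(conv_smooth cK cF F0 cL).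
  exists KL; split.
  - apply: continuous_compact; last exact: compact_setX.
    by apply: continuous_subspaceT => x; exact: add_continuous.
  - move=> _ [[x y] [/= Kx Ly] <-]; apply: (H3 x) => //.
    by rewrite opprD addrA subrr sub0r normrN (le_lt_trans (Lr _ Ly)).
  - by move=> x xKL; rewrite (conv_support F0 rho0 xKL) mulr0.
move=> x; split.
  by apply: approx => // y xy; apply/ltW/H1; exact: le_lt_trans rr1.
have -> : 'D_(basis_vec i) (fun x => c^-1 * conv F rho x) x =
    c^-1 * conv ('D_(basis_vec i) F) rho x.
  have [dcv <-] := Dconv x; exact: deriveZ.
by apply: approx => // y xy; apply/ltW/H2; exact: le_lt_trans rr2.
Qed.

(** The derivative of chi phi has integral 0 over the whole space ([Rintegral_derive0]), and it
    vanishes off [Omega]. *)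
Lemma test_weak_deriv phi i : test_fun Omega phi ->
  is_weak_deriv i phi ('D_(basis_vec i) phi).
Proof.
move=> tphi; split; [exact: test_L2|exact/test_L2/test_derive|move=> chi tchi].
apply/eqP; rewrite -addr_eq0 L2dotC [X in _ + X]L2dotC /Defs.L2dot.
have [sphi [K [cK KO phi0]]] := tphi; have [schi _] := tchi.
have sM : smooth (fun x => chi x * phi x) by exact: smoothM.
have i1 := L2M_integrable mO (test_L2 oO bO (test_derive i tchi)) (test_L2 oO bO tphi).
have i2 := L2M_integrable mO (test_L2 oO bO tchi) (test_L2 oO bO (test_derive i tphi)).
rewrite -RintegralD//; apply/eqP.
have M0 x : ~ K x -> chi x * phi x = 0 by move=> /phi0 ->; rewrite mulr0.
rewrite -(Rintegral_derive0 cK M0 (smooth_continuous sM)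
  (fun x => @smooth_derivable _ _ _ i x sM) (smooth_continuous (smooth_derive i sM))).
rewrite Rintegral_mkcond; apply: eq_Rintegral => x _; rewrite patchE.
have -> : 'D_(basis_vec i) (fun x => chi x * phi x) x =
    chi x * 'D_(basis_vec i) phi x + phi x * 'D_(basis_vec i) chi x.
  by rewrite (deriveM (@smooth_derivable _ _ _ i x schi) (@smooth_derivable _ _ _ i x sphi)).
case: ifPn => [_|/negP xO]; first by rewrite addrC [phi x * _]mulrC.
have Kx : ~ K x by move=> /KO Ox; apply: xO; rewrite inE.
have [_ ->] := derive_off_support (basis_vec i) cK phi0 Kx.
by rewrite phi0// mulr0 mul0r addr0.
Qed.

(** Stated through pairings, the form in which the choice made by [wD] is later traded for an
    explicit derivative. *)
Lemma weak_deriv_uniq i f g1 g2 : is_weak_deriv i f g1 -> is_weak_deriv i f g2 ->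
  forall h, L2 h -> L2dot g1 h = L2dot g2 h.
Proof.
move=> [Lf Lg1 H1] [_ Lg2 H2] h Lh; apply/eqP; rewrite -subr_eq0.
rewrite -(L2dotBl mO Lg1 Lg2 Lh); apply/eqP.
apply: (orth_test_eq0 oO bO (L2B mO Lg1 Lg2) Lh).
move=> chi tchi; rewrite (L2dotBl mO Lg1 Lg2 (test_L2 oO bO tchi)).
by apply/eqP; rewrite subr_eq0 -eqr_opp -H1// -H2.
Qed.

Lemma weak_derivB i f1 g1 f2 g2 : is_weak_deriv i f1 g1 -> is_weak_deriv i f2 g2 ->
  is_weak_deriv i (fun x => f1 x - f2 x) (fun x => g1 x - g2 x).
Proof.
move=> [Lf1 Lg1 H1] [Lf2 Lg2 H2]; split; [exact: L2B|exact: L2B|move=> phi tphi].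
have tD := test_derive i tphi.
rewrite (L2dotBl mO Lf1 Lf2 (test_L2 oO bO tD)) (L2dotBl mO Lg1 Lg2 (test_L2 oO bO tphi)).
by rewrite H1// H2// opprB opprK addrC.
Qed.

Lemma wDP i f : H1 Omega f -> is_weak_deriv i f (wD Omega i f).
Proof. by move=> [_ /(_ i)[g Hg]]; rewrite /wD; case: xgetP => [_ _ //|/(_ g)]. Qed.

(** Mollify [F] with error 1 / (m + 1). Uniform closeness gives closeness in L^2 on a set of finite
    measure, so both sides of the defining identity converge. *)
Lemma weak_deriv_C1 i h g (F : V -> R) (K : set V) : is_weak_deriv i h g ->
  compact K -> K `<=` Omega -> (forall x, ~ K x -> F x = 0) -> continuous F ->
  (forall x, derivable F x (basis_vec i)) -> continuous ('D_(basis_vec i) F) ->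
  L2dot h ('D_(basis_vec i) F) = - L2dot g F.
Proof.
move=> [Lh Lg Hw] cK KO F0 cF dF cDF.
have DF0 x : ~ K x -> 'D_(basis_vec i) F x = 0.
  by move=> Kx; have [] := derive_off_support (basis_vec i) cK F0 Kx.
have bnd f : continuous f -> (forall x, ~ K x -> f x = 0) -> L2 f.
  move=> cf f0; have [C _ fC] := compact_support_bounded cK cf f0.
  by apply: (L2_bounded mO Ofin (continuous_measurableO oO cf)) => x _; exact: fC.
have [LF LDF] := (bnd _ cF F0, bnd _ cDF DF0).
(* Mollification needs a kernel of positive mass; if [Omega] is null, all pairings vanish. *)
have [mu0|/eqP O0] := eqVneq (mu Omega) 0%E.
  have null f1 f2 : L2 f1 -> L2 f2 -> L2dot f1 f2 = 0.
    move=> L1 L2'; have m12 := measurable_int mu (L2M_integrable mO L1 L2').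
    by rewrite /Defs.L2dot /Rintegral (null_set_integral mO m12 mu0).
  by rewrite !null// oppr0.
have em0 (m : nat) : 0 < m.+1%:R^-1 :> R by [].
have /choice[chi chiP] : forall m : nat, exists chi : V -> R, test_fun Omega chi /\
    forall x, `|chi x - F x| <= m.+1%:R^-1 /\
      `|'D_(basis_vec i) chi x - 'D_(basis_vec i) F x| <= m.+1%:R^-1.
  by move=> m; have [chi tchi Hchi] := mollify O0 cK KO F0 cF dF cDF (em0 m); exists chi.
have tchi m := (chiP m).1; have Lchi m := test_L2 oO bO (tchi m).
have LDchi m := test_L2 oO bO (test_derive i (tchi m)).
have Hcvg (f : V -> R) (fm : nat -> V -> R) h' : L2 h' -> L2 f -> (forall m, L2 (fm m)) ->
    (forall m x, `|fm m x - f x| <= m.+1%:R^-1) ->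
    L2dot (fm m) h' @[m --> \oo] --> L2dot f h'.
  move=> Lh' Lf Lfm Hfm; apply: (L2dot_cvg mO Lfm Lf Lh').
  apply: (@squeeze_cvgr _ _ _ _ (fun=> 0)
      (fun m => m.+1%:R^-1 * Num.sqrt (fine (mu Omega)))).
  - apply: nearW => m; rewrite L2norm_ge0/=.
    have LB := L2B mO (Lfm m) Lf.
    by apply: (L2norm_bounded mO Ofin LB.1) => // x _; exact: Hfm.
  - exact: cvg_cst.
  - by rewrite -(mul0r (Num.sqrt (fine (mu Omega)))); apply: cvgMl; exact: cvg_harmonic.
have c1 := Hcvg _ _ _ Lh LDF LDchi (fun m x => ((chiP m).2 x).2).
have c2 := Hcvg _ _ _ Lg LF Lchi (fun m x => ((chiP m).2 x).1).
rewrite L2dotC [L2dot g _]L2dotC; apply: (cvg_unique _ c1); first exact: norm_hausdorff.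
rewrite (_ : (fun m => _) = fun m => - L2dot (chi m) g); first exact: cvgN.
by apply/funext => m; rewrite L2dotC Hw// L2dotC.
Qed.

End weak_derivatives.

(** * Products with C^1 coefficients and self-adjointness of elliptic operators *)

Section elliptic.
Context {R : realType} {n : nat}.
Local Notation V := 'rV[R]_n.+1.
Local Notation mu := (@lebesgueN R n).
Variable Omega : set V.
Hypothesis oO : open Omega.
Hypothesis bO : bounded_set Omega.
Let mO : measurable (Omega : set (Rn R n)) := measurable_open oO.
Let Ofin : (mu Omega < +oo)%E := bounded_lebesgueN_fin bO.
Local Notation L2 := (L2 Omega).
Local Notation L2dot := (L2dot Omega).
Local Notation L2norm := (L2norm Omega).
Local Notation is_weak_deriv := (is_weak_deriv Omega).
Local Notation wD := (wD Omega).

Lemma within_closure_continuous (f : V -> R) :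
  {within closure Omega, continuous f} -> {in Omega, continuous f}.
Proof.
move=> cf; rewrite -continuous_open_subspace//.
by apply: continuous_subspaceW cf; exact: subset_closure.
Qed.

Lemma compact_closure_Omega : compact (closure Omega).
Proof.
apply: bounded_closed_compact; last exact: closed_closure.
have [M [_ HM]] := bO; exists (`|M| + 1); split; first exact: num_real.
move=> N MN x clx; apply/ltW/le_lt_trans/MN.
have cB : closed [set y : V | `|y| <= `|M| + 1].
  have := @closed_le R (`|M| + 1) => /(closed_comp _); apply.
  by move=> y _; exact: norm_continuous.
apply: cB; apply: closure_subset clx => y Oy /=; apply: HM => //.
by have := ler_norm M; lra.
Qed.

Lemma within_closure_bounded (f : V -> R) :
  {within closure Omega, continuous f} -> exists C, forall x, Omega x -> `|f x| <= C.
Proof.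
move=> cf; have /compact_bounded[M [_ HM]] := continuous_compact cf compact_closure_Omega.
exists (`|M| + 1) => x Ox; apply: HM; first by have := ler_norm M; lra.
by exists x => //; exact: subset_closure.
Qed.

Lemma within_closure_measurable (f : V -> R) :
  {within closure Omega, continuous f} ->
  measurable_fun (Omega : set (Rn R n)) (f : Rn R n -> R).
Proof. by move=> /within_closure_continuous; exact: continuous_measurable_open. Qed.

Lemma L2_within_closureM (a h : V -> R) : {within closure Omega, continuous a} ->
  L2 h -> L2 (fun x => a x * h x).
Proof.
move=> ca Lh; have [C aC] := within_closure_bounded ca.
by apply: (L2Mbnd mO (within_closure_measurable ca) aC Lh).
Qed.

(** Outside [Omega] the factor [a] may be arbitrary, but [K] is closed and inside [Omega], so the
    product vanishes near every point outside. *)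
Lemma continuousM_support (a f : V -> R) (K : set V) : {in Omega, continuous a} ->
  compact K -> K `<=` Omega -> continuous f -> (forall x, ~ K x -> f x = 0) ->
  continuous (fun x => a x * f x).
Proof.
move=> ca cK KO cf f0 x; have [Ox|nOx] := pselect (Omega x).
  by apply: continuousM; [apply: ca; rewrite inE|exact: cf].
have nKx : ~ K x by move=> /KO.
have oK : open (~` K) by apply: closed_openC; exact: compact_closedN cK.
have nK : nbhs x (~` K) by exact: open_nbhs_nbhs.
have H : \forall y \near x, a y * f y = a x * f x.
  by near=> y; rewrite (f0 y) ?(f0 x) ?mulr0//; near: y.
exact: cvg_near_cst H.
Unshelve. all: by end_near. Qed.

(** For a test function phi, a phi is C^1 but not smooth, with compact support in [Omega]: it is
    admissible in [weak_deriv_C1], and the product rule rearranges the terms. *)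
Lemma weak_derivM (i : 'I_n.+1) (a da h g : V -> R) :
  {within closure Omega, continuous a} -> {within closure Omega, continuous da} ->
  (forall x, Omega x -> is_derive x (basis_vec i) a (da x)) ->
  is_weak_deriv i h g ->
  is_weak_deriv i (fun x => a x * h x) (fun x => a x * g x + da x * h x).
Proof.
move=> ca cda Da hg; have [Lh Lg _] := hg.
have Lah := L2_within_closureM ca Lh; have Lag := L2_within_closureM ca Lg.
have Ldah := L2_within_closureM cda Lh.
split; [exact: Lah|exact: (L2D mO Lag Ldah)|].
move=> phi tphi; have [sphi [K [cK KO phi0]]] := tphi.
have tD := test_derive i tphi.
have Lphi := test_L2 oO bO tphi; have LDphi := test_L2 oO bO tD.
have Dphi0 x : ~ K x -> 'D_(basis_vec i) phi x = 0.
  by move=> Kx; have [] := derive_off_support (basis_vec i) cK phi0 Kx.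
have caO := within_closure_continuous ca; have cdaO := within_closure_continuous cda.
pose F x := a x * phi x.
have F0 x : ~ K x -> F x = 0 by move=> /phi0; rewrite /F => ->; rewrite mulr0.
have cF : continuous F.
  exact: (continuousM_support caO cK KO (smooth_continuous sphi)).
pose F' x := a x * 'D_(basis_vec i) phi x + da x * phi x.
have cF' : continuous F'.
  have c1 := continuousM_support caO cK KO (smooth_continuous (smooth_derive i sphi)) Dphi0.
  have c2 := continuousM_support cdaO cK KO (smooth_continuous sphi) phi0.
  by move=> x; exact: (continuousD (c1 x) (c2 x)).
have dF x : is_derive x (basis_vec i) F (F' x).
  have [Ox|nOx] := pselect (Omega x); last first.
    have nKx : ~ K x by move=> /KO.
    rewrite /F' phi0// Dphi0// !mulr0 addr0.
    exact (derive_off_support (basis_vec i) cK F0 nKx).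
  have H := is_deriveM (Da x Ox) (DeriveDef (@smooth_derivable _ _ _ i x sphi) erefl).
  by apply: (is_derive_eq H); rewrite /F' [da x * _]mulrC.
have DF : 'D_(basis_vec i) F = F' by apply/funext => x; case: (dF x).
have := weak_deriv_C1 oO bO hg cK KO F0 cF (fun x => @ex_derive _ _ _ _ _ _ _ (dF x)).
rewrite DF => /(_ cF') H.
have LaD := L2_within_closureM ca LDphi; have Ldaphi := L2_within_closureM cda Lphi.
move: H; rewrite (L2dotDr mO LaD Ldaphi Lh) (L2dotDl mO Lag Ldah Lphi).
rewrite (_ : L2dot h (fun x => a x * _) =
  L2dot (fun x => a x * h x) ('D_(basis_vec i) phi)); last first.
  by apply: eq_Rintegral => x _; rewrite mulrCA mulrA.
rewrite (_ : L2dot h (fun x => da x * _) = L2dot (fun x => da x * h x) phi); last first.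
  by apply: eq_Rintegral => x _; rewrite mulrCA mulrA.
rewrite (_ : L2dot g F = L2dot (fun x => a x * g x) phi); last first.
  by apply: eq_Rintegral => x _; rewrite /F mulrCA mulrA.
by move=> H; rewrite opprD -H addrK.
Qed.

Lemma wD_weak_deriv i f : (exists g, is_weak_deriv i f g) ->
  is_weak_deriv i f (wD i f).
Proof. by move=> [g Hg]; rewrite /Defs.wD; case: xgetP => [_ _ //|/(_ g)]. Qed.

Lemma C1_closureM_wD i a h : C1_closure Omega a -> H1 Omega h ->
  is_weak_deriv i (fun x => a x * h x) (wD i (fun x => a x * h x)).
Proof.
move=> [ca /(_ i)[da cda Da]] [_ /(_ i)[g hg]]; apply: wD_weak_deriv.
by exists (fun x => a x * g x + da x * h x); exact: weak_derivM.
Qed.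

(** The identity defining [g] passes from test functions to their limits in the H^1 norm; this is
    integration by parts without boundary term. *)
Lemma weak_deriv_H10 i h g psi : is_weak_deriv i h g -> H10 Omega psi ->
  L2dot g psi = - L2dot h (wD i psi).
Proof.
move=> [Lh Lg Hw] [Hpsi [phi tphi cphi]].
have [Lpsi _] := Hpsi; have wpsi := wDP i Hpsi; have [_ LDpsi _] := wpsi.
have Lphi k := test_L2 oO bO (tphi k).
(* The H^1 norm of [e k] involves [wD i (e k)], chosen by [xget]; it agrees with the difference of
   the derivatives only inside pairings, through [weak_deriv_uniq]. *)
pose e k x := phi k x - psi x.
have we k : is_weak_deriv i (e k) (fun x => 'D_(basis_vec i) (phi k) x - wD i psi x).
  exact: (weak_derivB oO bO (test_weak_deriv oO bO i (tphi k)) wpsi).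
have wDe k : is_weak_deriv i (e k) (wD i (e k)).
  by apply: wD_weak_deriv; eexists; exact: we.
have LDe k : L2 (wD i (e k)) by have [] := wDe k.
have sum_ge0 (f : V -> R) : 0 <= \sum_j L2norm (wD j f) ^+ 2.
  by apply: sumr_ge0 => j _; exact: sqr_ge0.
have bound0 (f : V -> R) : L2norm f <= H1norm Omega f.
  rewrite -[leLHS]ger0_norm ?L2norm_ge0// -sqrtr_sqr ler_wsqrtr// lerDl//.
have bound1 (f : V -> R) : L2norm (wD i f) <= H1norm Omega f.
  rewrite -[leLHS]ger0_norm ?L2norm_ge0// -sqrtr_sqr ler_wsqrtr//.
  rewrite (bigD1 i)//= addrCA lerDl addr_ge0 ?sqr_ge0//.
  by apply: sumr_ge0 => j _; exact: sqr_ge0.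
have c0 : L2norm (e k) @[k --> \oo] --> 0.
  apply: (@squeeze_cvgr _ _ _ _ (fun=> 0) (fun k => H1norm Omega (e k))) => //.
    by apply: nearW => k; rewrite L2norm_ge0/=.
  exact: cvg_cst.
have c1 : L2norm (fun x => wD i (e k) x - 0) @[k --> \oo] --> 0.
  apply: (@squeeze_cvgr _ _ _ _ (fun=> 0) (fun k => H1norm Omega (e k))) => //.
    apply: nearW => k; rewrite L2norm_ge0/=.
    by under [X in L2norm X]eq_fun do rewrite subr0.
  exact: cvg_cst.
have l0 := L2dot_cvg mO Lphi Lpsi Lg c0.
have l1 := L2dot_cvg mO LDe (L2_0 Omega) Lh c1.
rewrite L2dotC [L2dot h _]L2dotC.
apply: (cvg_unique _ l0); first exact: norm_hausdorff.
rewrite (_ : (fun k => _) =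
  fun k => - (L2dot (wD i (e k)) h + L2dot (wD i psi) h)); last first.
  apply/funext => k; rewrite L2dotC; apply/eqP; rewrite -eqr_oppLR; apply/eqP.
  rewrite -Hw// (weak_deriv_uniq oO bO (wDe k) (we k) Lh).
  have LDphi := test_L2 oO bO (test_derive i (tphi k)).
  by rewrite (L2dotBl mO LDphi LDpsi Lh) subrK L2dotC.
rewrite -[X in - X]add0r; apply: cvgN; apply: cvgD; last exact: cvg_cst.
by rewrite -(L2dot0l Omega h).
Qed.

Variables (a : 'I_n.+1 -> 'I_n.+1 -> V -> R) (c : V -> R).
Hypothesis ac_elliptic : elliptic_coeffs Omega a c.

Lemma elliptic_op_L2 w : H2 Omega w -> L2 (elliptic_op Omega a c w).
Proof.
move=> [[Lw _] Hw]; have [Ca [Cc _] _ _ _] := ac_elliptic.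
apply: (L2B mO _ (L2_within_closureM Cc Lw)).
apply: (L2N mO); apply: (L2_sum mO) => i _; apply: (L2_sum mO) => j _.
by have [] := C1_closureM_wD i (Ca i j) (Hw j).
Qed.

Lemma elliptic_op_form w psi : H2 Omega w -> H10 Omega psi ->
  L2dot (elliptic_op Omega a c w) psi =
  \sum_i \sum_j L2dot (fun x => a i j x * wD j w x) (wD i psi)
    - L2dot (fun x => c x * w x) psi.
Proof.
move=> [[Lw _] Hw] Hpsi; have [Ca [Cc _] _ _ _] := ac_elliptic.
have Lpsi : L2 psi by have [[]] := Hpsi.
have H i j := C1_closureM_wD i (Ca i j) (Hw j).
have LH i j : L2 (wD i (fun x => a i j x * wD j w x)) by have [] := H i j.
have LS i : L2 (fun x => \sum_j wD i (fun x => a i j x * wD j w x) x).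
  by apply: L2_sum => // j _; exact: LH.
have LSS : L2 (fun x => \sum_i \sum_j wD i (fun x => a i j x * wD j w x) x).
  by apply: L2_sum => // i _; exact: LS.
have Lc := L2_within_closureM Cc Lw.
rewrite /elliptic_op (L2dotBl mO (L2N mO LSS) Lc Lpsi) (L2dotNl mO LSS Lpsi).
congr (_ - _).
rewrite (L2dot_suml mO _ (fun i _ => LS i) Lpsi) -sumrN; apply: eq_bigr => i _.
rewrite (L2dot_suml mO _ (fun j _ => LH i j) Lpsi) -sumrN; apply: eq_bigr => j _.
by rewrite (weak_deriv_H10 (H i j) Hpsi) opprK.
Qed.

(** Both sides equal the bilinear form of [elliptic_op_form], which is symmetric because a_ij =
    a_ji. *)
Lemma elliptic_op_selfadjoint w psi : dom_op Omega w -> dom_op Omega psi ->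
  L2dot (elliptic_op Omega a c w) psi = L2dot w (elliptic_op Omega a c psi).
Proof.
move=> [H2w H10w] [H2psi H10psi]; have [_ _ sym _ _] := ac_elliptic.
rewrite (elliptic_op_form H2w H10psi) (L2dotC Omega w) (elliptic_op_form H2psi H10w).
have -> : L2dot (fun x => c x * w x) psi = L2dot (fun x => c x * psi x) w.
  by apply: eq_Rintegral => x _; rewrite mulrAC.
apply: (congr1 (fun s => s - _)).
rewrite [LHS]exchange_big; apply: eq_bigr => i _; apply: eq_bigr => j _.
apply: eq_Rintegral => x; rewrite inE => Ox.
rewrite (sym j i); last exact: subset_closure.
by move: (a i j x) (wD i w x) (wD j psi x) => p q r; rewrite mulrAC.
Qed.

End elliptic.

(** * The fractional kernel *)

Section improper_integrals.
Context {R : realType}.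
Local Notation leb := (@lebesgue_measure R).

(** Serves integrands that are singular at an endpoint: monotone convergence along compact
    subintervals exhausting the open one. *)
Lemma ge0_FTC2_oo (f F : R -> R) (a b Fa Fb : R) : a < b ->
  (forall x, a < x < b -> 0 <= f x) -> {in `]a, b[, continuous f} ->
  (forall x, a < x < b -> is_derive x 1 F (f x)) ->
  F x @[x --> a^'+] --> Fa -> F x @[x --> b^'-] --> Fb ->
  (\int[leb]_(x in `]a, b[) (f x)%:E = (Fb - Fa)%:E)%E.
Proof.
move=> ab f0 cf dF Fa_cvg Fb_cvg.
(* A third of the length keeps [am m < bm m] already for m = 0. *)
pose d m : R := (b - a) / 3 * m.+1%:R^-1.
have q0 : 0 < (b - a) / 3 by lra.
have d0 m : 0 < d m by rewrite mulr_gt0.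
have dle m : d m <= (b - a) / 3.
  by rewrite /d -[leRHS]mulr1 ler_pM2l// invf_le1// ler1n.
have dcvg : d m @[m --> \oo] --> 0.
  by rewrite -(mulr0 ((b - a) / 3)); apply: cvgMr; exact: cvg_harmonic.
pose am m := a + d m; pose bm m := b - d m.
have abm m : am m < bm m by have := dle m; rewrite /am /bm; lra.
have in_ab m x : am m <= x <= bm m -> a < x < b.
  by have := d0 m; rewrite /am /bm => ? /andP[? ?]; apply/andP; split; lra.
have cFx x : a < x < b -> {for x, continuous F}.
  move=> xab; apply/differentiable_continuous/derivable1_diffP.
  by case: (dF x xab).
have Fm m : (\int[leb]_(x in `[am m, bm m]) (f x)%:E = (F (bm m) - F (am m))%:E)%E.
  rewrite EFinB; apply: continuous_FTC2 => //.
  - apply: continuous_in_subspaceT => x; rewrite inE/= in_itv/= => /in_ab xab.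
    by apply: cf; rewrite in_itv/=.
  - split.
    + move=> x; rewrite in_itv/= => /andP[x1 x2].
      by have [] := dF x (in_ab m x _); rewrite ?ltW.
    + apply: cvg_at_right_filter; apply: cFx; apply: (in_ab m).
      by rewrite lexx ltW.
    + apply: cvg_at_left_filter; apply: cFx; apply: (in_ab m).
      by rewrite lexx ltW.
  - move=> x; rewrite in_itv/= => /andP[x1 x2].
    have [] := dF x (in_ab m x _); rewrite ?ltW//.
    by rewrite derive1E.
have mab (D : set R) : D `<=` `]a, b[ -> measurable D -> measurable_fun D (EFin \o f).
  move=> Dab mD; apply/measurable_EFinP.
  apply: (measurable_funS _ Dab) => //.
  apply: open_continuous_measurable_fun; first exact: interval_open.
  by move=> x; rewrite inE/= => xab; exact: cf.
have sub m : `[am m, bm m]%classic `<=` `]a, b[%classic.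
  by move=> x /=; rewrite !in_itv/=; exact: in_ab.
have -> : `]a, b[%classic = \bigcup_m `[am m, bm m]%classic.
  apply/seteqP; split; last by move=> x [m _]; exact: sub.
  move=> x; rewrite /= in_itv/= => /andP[ax xb].
  have e0 : 0 < Num.min (x - a) (b - x) by rewrite lt_min !subr_gt0 ax.
  have /cvgrPdist_lt/(_ _ e0)[N _ /(_ N (leqnn _))] := dcvg.
  rewrite sub0r normrN gtr0_norm// lt_min => /andP[? ?].
  by exists N => //=; rewrite in_itv/= /am /bm; apply/andP; split; lra.
apply: (cvg_unique _ (ge0_nondecreasing_set_cvg_integral _ _ _ _)).
- by [].
- apply/nondecreasing_seqP => m; rewrite subsetEset => x /=; rewrite !in_itv/=.
  have : d m.+1 <= d m.
    rewrite /d ler_pM2l// lef_pV2 ?posrE//.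
    by rewrite ler_nat.
  by rewrite /am /bm => ? /andP[? ?]; apply/andP; split; lra.
- by move=> m; exact: measurable_itv.
- by move=> m; apply: mab => //; exact: measurable_itv.
- by move=> m x /sub; rewrite /= in_itv/= => /f0; rewrite lee_fin.
rewrite (_ : (fun m => _) = fun m => (F (bm m) - F (am m))%:E); last first.
  by apply/funext => m; rewrite Fm.
apply: cvg_EFin; first exact: nearW.
apply: cvgB.
  apply: (iffLR (cvg_at_leftP _ _ _) Fb_cvg); split.
    by move=> m; rewrite /bm; have := d0 m; lra.
  by rewrite -[X in _ --> X]subr0; apply: cvgB => //; exact: cvg_cst.
apply: (iffLR (cvg_at_rightP _ _ _) Fa_cvg); split.
  by move=> m; rewrite /am; have := d0 m; lra.
by rewrite -[X in _ --> X]addr0; apply: cvgD => //; exact: cvg_cst.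
Qed.

Lemma continuous_powR_gt0 (s x : R) : 0 < x -> {for x, continuous (@powR R ^~ s)}.
Proof.
move=> x0; apply/differentiable_continuous/derivable1_diffP.
by case: (@is_derive1_powR R s x x0).
Qed.

Lemma integral_powR01 (s : R) : 0 < s ->
  (\int[leb]_(x in `]0%R, 1%R[) (x `^ (s - 1))%:E = (s^-1)%:E)%E.
Proof.
move=> s0; rewrite -[in RHS](subr0 s^-1).
apply: (@ge0_FTC2_oo _ (fun x => s^-1 * x `^ s)) => //.
- by move=> x _; exact: powR_ge0.
- by move=> x; rewrite in_itv/= => /andP[x0 _]; exact: continuous_powR_gt0.
- move=> x /andP[x0 _]; have H := is_deriveZ s^-1 (@is_derive1_powR R s x x0).
  by apply: (is_derive_eq H); rewrite /GRing.scale/= mulrA mulVf ?mul1r// gt_eqF.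
- by rewrite -[X in _ --> X](mulr0 s^-1); apply: cvgMr; exact: powR_cvg0.
- have e1 : s^-1 = s^-1 * 1 `^ s by rewrite powR1 mulr1.
  rewrite [X in _ --> X]e1; apply: cvgMr.
  by apply: cvg_at_left_filter; exact: continuous_powR_gt0.
Qed.

Lemma integral_frac_kernel (s t : R) : 0 < s -> 0 < t ->
  (\int[leb]_(x in `]0%R, t[) ((t - x) `^ (s - 1))%:E = (s^-1 * t `^ s)%:E)%E.
Proof.
move=> s0 t0.
have dsub (x : R) : is_derive x 1 (fun y => t - y) (-1).
  have H := is_deriveB (is_derive_cst t x 1) (is_derive_id x 1).
  by apply: (is_derive_eq H); rewrite sub0r.
have csub (x : R) : {for x, continuous (fun y => t - y)}.
  by apply: continuousB; [exact: cst_continuous|exact: cvg_id].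
rewrite -[in RHS](opprK (s^-1 * _)) -[in RHS]sub0r -mulNr.
apply: (@ge0_FTC2_oo _ (fun x => - s^-1 * (t - x) `^ s)).
- exact: t0.
- by move=> x _; exact: powR_ge0.
- move=> x; rewrite in_itv/= => /andP[x0 xt].
  apply: (@continuous_comp _ _ _ (fun y => t - y) (@powR R ^~ (s - 1))) => //.
  by apply: continuous_powR_gt0; rewrite subr_gt0.
- move=> x /andP[x0 xt]; have tx0 : 0 < t - x by rewrite subr_gt0.
  have H := is_deriveZ (- s^-1)
    (@is_derive1_comp R (@powR R ^~ s) (fun y => t - y) x _ _ (@is_derive1_powR R s (t - x) tx0) (dsub x)).
  by apply: (is_derive_eq H); rewrite /GRing.scale/=; field; rewrite gt_eqF.
- apply: cvgMr; apply: cvg_at_right_filter.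
  rewrite -[X in _ --> X `^ s](subr0 t).
  apply: (@continuous_comp _ _ _ (fun y => t - y) (@powR R ^~ s)) => //.
  by apply: continuous_powR_gt0; rewrite subr0.
- rewrite -[X in _ --> X](mulr0 (- s^-1)); apply: cvgMr.
  apply/cvg_at_leftP => u [ut ucvg].
  apply: (iffLR (cvg_at_rightP _ _ _) (powR_cvg0 s0)); split.
    by move=> m; rewrite subr_gt0.
  by rewrite -(subrr t); apply: cvgB => //; exact: cvg_cst.
Qed.

(** Finiteness matters too, because [Rintegral] takes the value 0 when the integral is infinite. For
    s <= 1 the integrand is at most t^(s - 1) on ]0, 1[ and exp(- t) beyond, and at least exp(- 1)
    on ]0, 1[. *)
Lemma Gamma_fun_gt0 (s : R) : 0 < s <= 1 -> 0 < Gamma_fun s.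
Proof.
move=> /andP[s0 s1]; pose f (t : R) := t `^ (s - 1) * expR (- t).
have f_ge0 t : 0 <= f t by rewrite mulr_ge0 ?powR_ge0 ?expR_ge0.
have mf (D : set R) : measurable_fun D f.
  apply: measurable_funTS; apply: measurable_funM; first exact: measurable_powR.
  by apply: measurableT_comp => //; exact: oppr_measurable.
pose I := (\int[leb]_(t in `]0%R, +oo[) (f t)%:E)%E.
have Ioo : (I < +oo)%E.
  pose h1 := ((fun t : R => (t `^ (s - 1))%:E) \_ `]0%R, 1%R[)%E.
  pose h2 (t : R) := (exponential_pdf 1 t)%:E.
  have h1_ge0 t : (0 <= h1 t)%E.
    by apply: erestrict_ge0 => y _; rewrite lee_fin powR_ge0.
  have h2_ge0 t : (0 <= h2 t)%E by rewrite lee_fin exponential_pdf_ge0.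
  have mh1 : measurable_fun setT h1.
    apply/(measurable_restrictT _ _).1 => //; apply/measurable_EFinP.
    by apply: measurable_funTS; exact: measurable_powR.
  have mh2 : measurable_fun setT h2.
    by apply/measurable_EFinP; exact: measurable_exponential_pdf.
  apply: (@le_lt_trans _ _ (\int[leb]_t (h1 t + h2 t))%E); last first.
    rewrite ge0_integralD// -integral_mkcond integral_powR01//.
    by rewrite integral_exponential_pdf// -EFinD ltry.
  apply: (@le_trans _ _ (\int[leb]_(t in `]0%R, +oo[) (h1 t + h2 t))%E).
    apply: ge0_le_integral => //.
    - by move=> t _; rewrite lee_fin f_ge0.
    - by apply/measurable_EFinP; exact: mf.
    - by apply: measurable_funTS; exact: emeasurable_funD.
    - move=> t; rewrite /= in_itv/= andbT => t0; have [t1|t1] := ltP t 1.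
        apply: (@le_trans _ _ (h1 t)); last by rewrite leeDl.
        rewrite /h1 patchE mem_set/=; last by rewrite in_itv/= t0.
        rewrite lee_fin -[leRHS]mulr1 ler_wpM2l ?powR_ge0// -expR0 ler_expR.
        by rewrite oppr_le0 ltW.
      apply: (@le_trans _ _ (h2 t)); last by rewrite leeDr.
      rewrite /h2 lee_fin exponential_pdfE ?(ltW t0)// mul1r mulN1r.
      rewrite -[leRHS]mul1r ler_wpM2r ?expR_ge0// -[leRHS](powRr0 t) ler_powR//.
      by rewrite subr_le0.
  apply: ge0_subset_integral => //; first exact: emeasurable_funD.
  by move=> t _; rewrite adde_ge0.
have I0 : (0 < I)%E.
  apply: (@lt_le_trans _ _ (expR (- 1))%:E); first by rewrite lte_fin expR_gt0.
  apply: (@le_trans _ _ (\int[leb]_(t in `]0%R, 1%R[) (expR (- 1))%:E)%E).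
    have l1 : (@lebesgue_measure R `]0%R, 1%R[%classic = 1)%E.
      by rewrite lebesgue_measure_itv/= lte_fin ltr01 oppr0 adde0.
    rewrite integral_cst// [X in (_ <= _ * X)%E](_ : _ = 1%E); last exact: l1.
    by rewrite mule1.
  apply: (@le_trans _ _ (\int[leb]_(t in `]0%R, 1%R[) (f t)%:E)%E).
    apply: ge0_le_integral => //.
    - by apply/measurable_EFinP; exact: mf.
    - move=> t; rewrite /= in_itv/= => /andP[t0 t1].
      rewrite lee_fin -[leLHS]mul1r; apply: ler_pM; rewrite ?expR_ge0//.
        by rewrite -[leLHS](powRr0 t) ger_powR ?t0 ?(ltW t1)// subr_le0.
      by rewrite ler_expR lerN2 ltW.
  apply: ge0_subset_integral => //.
  - by apply/measurable_EFinP; exact: mf.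
  - by move=> t _; rewrite lee_fin f_ge0.
  - by apply: subset_itvl; rewrite bnd_simp.
by rewrite /Gamma_fun /Rintegral -/I fine_gt0// I0.
Qed.

End improper_integrals.

(** * Pairing with a Bochner integral *)

(** No measurability of [g] is assumed: off the null set, every simple function below [f] is below
    [g], and both integrals are suprema over simple functions. *)
Lemma ae_le_integral_ge0 d (T : measurableType d) (R : realType)
    (mu : {measure set T -> \bar R}) (D : set T) (f g : T -> \bar R) :
  measurable D -> measurable_fun D f -> (forall x, D x -> 0 <= f x)%E ->
  (forall x, D x -> 0 <= g x)%E -> {ae mu, forall x, D x -> (f x <= g x)%E} ->
  (\int[mu]_(x in D) f x <= \int[mu]_(x in D) g x)%E.
Proof.
move=> mD mf f0 g0 [N [mN N0 HN]].
rewrite (ge0_negligible_integral mN mD mf f0 N0).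
rewrite !ge0_integralE//; last by move=> x [Dx _]; exact: f0.
apply: ge_ereal_sup => _ [h hf <-]; apply: ereal_sup_ubound; exists h => // x.
apply: le_trans (hf x) _; rewrite !patchE.
case: ifPn => [|_]; last by case: ifPn => // /set_mem; exact: g0.
rewrite inE => -[Dx nNx]; rewrite mem_set//.
by apply: contrapT => nfg; apply: nNx; apply: HN => /(_ Dx).
Qed.

Section bochner_pairing.
Context {R : realType} {n : nat}.
Local Notation V := 'rV[R]_n.+1.
Local Notation leb := (@lebesgue_measure R).
Variable Omega : set V.
Hypothesis oO : open Omega.
Hypothesis bO : bounded_set Omega.
Let mO : measurable (Omega : set (Rn R n)) := measurable_open oO.
Local Notation L2 := (L2 Omega).
Local Notation L2dot := (L2dot Omega).
Local Notation L2norm := (L2norm Omega).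
Implicit Types (s : simple_vfun R V) (E : set R).

Lemma L2_simple_eval E s t : simple_on L2 E s -> L2 (simple_eval s t).
Proof.
move=> son; apply: (L2_sum mO) => j _; apply: (L2Z mO).
by have [] := son j.
Qed.

Lemma L2dot_simple_eval E s t psi : simple_on L2 E s -> L2 psi ->
  L2dot (simple_eval s t) psi =
  \sum_(j < sv_size s) \1_(sv_set s j) t * L2dot (sv_val s j) psi.
Proof.
move=> son Lpsi; have Lv j : L2 (sv_val s j) by have [] := son j.
rewrite /simple_eval (L2dot_suml mO) => [|j _|//]; last exact: L2Z.
by apply: eq_bigr => j _; rewrite (L2dotZl mO).
Qed.

Lemma integral_simple_eval E s psi : measurable E -> simple_on L2 E s -> L2 psi ->
  leb.-integrable E (EFin \o (fun t => L2dot (simple_eval s t) psi)) /\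
  \int[leb]_(t in E) L2dot (simple_eval s t) psi = L2dot (simple_integral s) psi.
Proof.
move=> mE son Lpsi; have Lv j : L2 (sv_val s j) by have [] := son j.
pose q j := L2dot (sv_val s j) psi.
have ij j : leb.-integrable E (fun t => (\1_(sv_set s j) t * q j)%:E).
  have [mj jE jfin _] := son j.
  have := @integrableZr _ _ _ leb E mE (q j) (fun t => (\1_(sv_set s j) t)%:E).
  apply; apply/integrableP; split.
    by apply/measurable_EFinP; exact: measurable_indic.
  under eq_integral do rewrite gee0_abs ?lee_fin//.
  by rewrite integral_indic// (setIidl jE).
have E1 t : L2dot (simple_eval s t) psi = \sum_(j < sv_size s) \1_(sv_set s j) t * q j.
  exact: L2dot_simple_eval son Lpsi.
have E2 : EFin \o (fun t => L2dot (simple_eval s t) psi) =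
    (fun t => \sum_(j < sv_size s) (\1_(sv_set s j) t * q j)%:E)%E.
  by apply/funext => t /=; rewrite E1 sumEFin.
split; first by rewrite E2; apply: integrable_sum => // j _; exact: ij.
rewrite /Rintegral (_ : (fun t => _) =
    (fun t => \sum_(j < sv_size s) (\1_(sv_set s j) t * q j)%:E)%E) ?E2//.
rewrite integral_sum//.
have E3 j : (\int[leb]_(t in E) (\1_(sv_set s j) t * q j)%:E =
    (fine (leb (sv_set s j)) * q j)%:E)%E.
  have [mj jE jfin _] := son j.
  under eq_integral do rewrite EFinM.
  rewrite integralZr//; last first.
    apply/integrableP; split.
      by apply/measurable_EFinP; exact: measurable_indic.
    under eq_integral do rewrite gee0_abs ?lee_fin//.
    by rewrite integral_indic// (setIidl jE).
  rewrite integral_indic// (setIidl jE) EFinM; congr (_ * _)%E.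
  by rewrite fineK ?ge0_fin_numE.
under eq_bigr do rewrite E3.
rewrite sumEFin /= /simple_integral (L2dot_suml mO) => [|j _|//]; last exact: L2Z.
by apply: eq_bigr => j _; rewrite (L2dotZl mO).
Qed.

Lemma L2_simple_integral E s : simple_on L2 E s -> L2 (simple_integral s).
Proof.
move=> son; apply: (L2_sum mO) => j _; apply: (L2Z mO).
by have [] := son j.
Qed.

(* Only norms of simple_eval - k w are integrated, so the measurability of
   t |-> L2dot (w t) psi plays no role. *)
Lemma bochner_pairing_bound (psi : V -> R) (w : R -> V -> R) (v : V -> R)
    (k : R -> R) E (c0 e K : R) :
  L2 psi -> measurable E -> (forall t, E t -> 0 <= k t) -> measurable_fun E k ->
  (\int[leb]_(t in E) (k t)%:E = K%:E)%E -> 0 <= e ->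
  is_bochner_integral L2 L2norm E (fun t x => k t * w t x) v ->
  {ae leb, forall t, E t -> L2 (w t) /\ `|L2dot (w t) psi - c0| <= e} ->
  `|L2dot v psi - c0 * K| <= e * K.
Proof.
move=> Lpsi mE k0 mk kK e0 [Lv _ [s [son sN sint]]] wae.
have mEl : measurable (E : set (measurableTypeR R)) by exact: mE.
have ik : leb.-integrable E (EFin \o k).
  apply/integrableP; split; first exact/measurable_EFinP.
  rewrite (@eq_integral _ _ _ leb E (EFin \o k)) ?kK ?ltry//.
  by move=> x; rewrite inE => Ex /=; rewrite ger0_norm// k0.
have kK' : \int[leb]_(t in E) k t = K by rewrite /Rintegral kK.
pose p m t := L2dot (simple_eval (s m) t) psi.
have ip m : leb.-integrable E (EFin \o p m).
  by have [] := integral_simple_eval mE (son m) Lpsi.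
pose D m t := p m t - c0 * k t.
have iD m : leb.-integrable E (EFin \o D m).
  by have := integrableB mEl (ip m) (integrableZl mEl c0 ik); apply: eq_integrable.
(* This excess over the tolerance is measurable, and almost everywhere at most Psi times the norm of
   simple_eval - k w: the remaining part of [D m t], namely k ((w, psi) - c0), is at most e k. Its
   integral therefore tends to 0. *)
pose B m t := Num.max 0 (`|D m t| - e * k t).
have mB m : measurable_fun E (B m).
  apply: measurable_maxr => //; apply: measurable_funB.
    by apply: measurableT_comp => //; apply/measurable_EFinP; exact: (measurable_int leb (iD m)).
  exact: measurable_funM.
have B0 m t : 0 <= B m t by rewrite le_max lexx.
have iB m : leb.-integrable E (EFin \o B m).
  apply: (le_integrable mEl _ _ (iD m)); first by apply/measurable_EFinP; exact (mB m).
  move=> t Et /=; rewrite lee_fin ger0_norm// ge_max normr_ge0/=.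
  by rewrite gerBl mulr_ge0// k0.
pose Psi := L2norm psi + 1; have Psi0 : 0 < Psi by rewrite ltr_wpDl// L2norm_ge0.
pose M m := (\int[leb]_(t in E) (L2norm (fun x => simple_eval (s m) t x - k t * w t x))%:E)%E.
have BM m : ((Psi^-1 * \int[leb]_(t in E) B m t)%:E <= M m)%E.
  have iPB : leb.-integrable E (EFin \o (fun t => Psi^-1 * B m t)).
    exact: (integrableZl mEl Psi^-1 (iB m)).
  rewrite -RintegralZl// /Rintegral fineK; last exact: integrable_fin_num.
  apply: ae_le_integral_ge0 => //.
  - exact: (measurable_int leb iPB).
  - by move=> t _; rewrite lee_fin mulr_ge0// invr_ge0 ltW.
  - by move=> t _; rewrite lee_fin L2norm_ge0.
  move: wae; apply: (@filterS _ _ (ae_filter_ringOfSetsType leb)) => t wt Et; have [Lwt wte] := wt Et.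
  have Lse := L2_simple_eval t (son m); have Lkw := L2Z mO (k t) Lwt.
  rewrite lee_fin mulrC ler_pdivrMr// mulrC ge_max; apply/andP; split.
    by rewrite mulr_ge0 ?L2norm_ge0// ltW.
  have -> : D m t = L2dot (fun x => simple_eval (s m) t x - k t * w t x) psi +
      k t * (L2dot (w t) psi - c0).
    by rewrite (L2dotBl mO Lse Lkw Lpsi) (L2dotZl mO _ Lwt Lpsi) /D /p; ring.
  rewrite lerBlDr; apply: le_trans (ler_normD _ _) _; apply: lerD.
    apply: le_trans (L2_CS mO (L2B mO Lse Lkw) Lpsi) _.
    have := L2norm_ge0 Omega (fun x => simple_eval (s m) t x - k t * w t x).
    by rewrite /Psi; lra.
  by rewrite normrM (ger0_norm (k0 _ Et)) mulrC ler_wpM2r ?k0.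
have pM m : `|L2dot (simple_integral (s m)) psi - c0 * K| <=
    \int[leb]_(t in E) B m t + e * K.
  have [_ <-] := integral_simple_eval mE (son m) Lpsi.
  rewrite -kK' -!RintegralZl// -RintegralB//; [|exact: (ip m)|exact: (integrableZl mEl c0 ik)].
  apply: le_trans (le_normr_Rintegral mEl (iD m)) _.
  rewrite -RintegralD//; last exact: (integrableZl mEl e ik).
  apply: le_Rintegral => //.
  - exact: integrable_norm (iD m).
  - exact: (integrableD mEl (iB m) (integrableZl mEl e ik)).
  - by move=> t Et; rewrite -lerBlDr /B le_max lexx orbT.
have sp : L2dot (simple_integral (s m)) psi @[m --> \oo] --> L2dot v psi.
  exact: (L2dot_cvg mO (fun m => L2_simple_integral (son m)) Lv Lpsi sint).
apply/ler_addgt0Pr => eta eta0.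
have e1 : 0 < eta / 2 by rewrite divr_gt0.
have e2 : (0 < (Psi^-1 * (eta / 2))%:E)%E by rewrite lte_fin mulr_gt0// invr_gt0.
have /cvgrPdist_lt/(_ _ e1) near1 := sp.
have near2 : \forall m \near \oo, (M m < (Psi^-1 * (eta / 2))%:E)%E.
  have : nbhs (0%:E : \bar R) [set y | (y < (Psi^-1 * (eta / 2))%:E)%E].
    by apply: open_nbhs_nbhs; split => //; exact: open_ereal_lt_ereal.
  exact: sN.
have [m [m1 m2]] := filter_ex (filterI near1 near2).
have Bm : \int[leb]_(t in E) B m t < eta / 2.
  have := le_lt_trans (BM m) m2.
  by rewrite lte_fin ltr_pM2l// invr_gt0.
have := pM m.
have -> : L2dot v psi - c0 * K = (L2dot v psi - L2dot (simple_integral (s m)) psi) +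
  (L2dot (simple_integral (s m)) psi - c0 * K) by ring.
move=> H; apply: le_trans (ler_normD _ _) _.
apply: (@le_trans _ _ (eta / 2 + (eta / 2 + e * K))).
  by apply: lerD; [exact: ltW|rewrite (le_trans H)// lerD2r ltW].
by rewrite addrA -splitr addrC.
Qed.

End bochner_pairing.

(** * Asymptotics at the initial time *)

Section real_asymptotics.
Context {R : realType}.
Local Notation leb := (@lebesgue_measure R).

Lemma powR_small (s e : R) : 0 < s -> 0 < e ->
  exists2 d : R, 0 < d & forall t, 0 < t < d -> t `^ s < e.
Proof.
move=> s0 e0; have /cvgrPdist_lt/(_ _ e0)[d /= d0 Hd] := powR_cvg0 s0.
exists d => // t /andP[t0 td].
have := Hd t; rewrite /= !sub0r !normrN (gtr0_norm t0) ger0_norm ?powR_ge0//.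
by apply.
Qed.

(** A null set cannot contain ]0, d[. This supplies the small times at which both expansions
    hold. *)
Lemma lebesgue_ae_exists (P : R -> Prop) (d : R) : 0 < d ->
  {ae leb, forall t, P t} -> exists2 t, 0 < t < d & P t.
Proof.
move=> d0 [N [mN N0 HN]]; apply: contrapT => H.
have : (leb `]0%R, d[%classic <= leb N)%E.
  have mI : measurable (`]0%R, d[%classic : set (measurableTypeR R)).
    exact: measurable_itv.
  apply: (@le_measure _ _ _ leb); rewrite ?inE//.
  move=> t; rewrite /= in_itv/= => td.
  by apply: (HN t) => Pt; apply: H; exists t.
rewrite leNgt => /negP; apply.
rewrite [X in (X < _)%E]N0 lebesgue_measure_itv/= lte_fin d0 oppr0 adde0.
by rewrite lte_fin.
Qed.

(** Dividing by t^al leaves [A] plus terms in t^(be - al), which tend to 0, so the smaller exponent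
    cannot be cancelled. *)
Lemma powR_asymptotics_aux (al be A B : R) : 0 < al -> al < be -> A != 0 ->
  ~ (forall e d, 0 < e -> 0 < d -> exists2 t, 0 < t < d &
      `|A * t `^ al - B * t `^ be| <= e * (t `^ al + t `^ be)).
Proof.
move=> al0 albe A0 H; have A'0 : 0 < `|A| by rewrite normr_gt0.
have e0 : 0 < `|A| / 4 by rewrite divr_gt0.
have c0 : 0 < `|B| + `|A| / 4 by rewrite ltr_wpDl.
have bal : 0 < be - al by rewrite subr_gt0.
(* On ]0, d[ this gives t^(be - al) (|B| + |A|/4) < |A|/4. With e = |A|/4 the assumed bound would
   then force |A| - |A|/4 < |A|/4. *)
have [d d0 Hd] := powR_small bal (divr_gt0 e0 c0).
have [t td Ht] := H _ _ e0 d0; have /andP[t0 _] := td.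
have := Hd t td; rewrite ltr_pdivlMr// => Hs.
have ta : 0 < t `^ al by rewrite powR_gt0.
have tb : 0 < t `^ (be - al) by rewrite powR_gt0.
have tbe : t `^ be = t `^ al * t `^ (be - al).
  have E : be = al + (be - al) by ring.
  by rewrite [in LHS]E powRD// (gt_eqF t0) implybT.
have : `|A| * t `^ al - `|B| * t `^ be <= `|A * t `^ al - B * t `^ be|.
  rewrite -[X in _ * X - _](gtr0_norm ta) -normrM.
  have tbe0 : 0 < t `^ be by rewrite powR_gt0.
  by rewrite -[X in _ - _ * X](gtr0_norm tbe0) -normrM lerB_dist.
move=> /le_trans/(_ Ht); rewrite tbe.
move: ta tb Hs; set p := t `^ al; set q := t `^ (be - al) => ta tb Hs.
move=> K; have : p * (`|A| - `|A| / 4 - q * (`|B| + `|A| / 4)) <= 0 by lra.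
by rewrite pmulr_rle0//; lra.
Qed.

(** One suitable t in each ]0, d[ is all that is asked, since the expansions hold only almost
    everywhere. *)
Lemma powR_asymptotics_match (al be xa xb A B : R) : 0 < al -> 0 < be ->
  A != 0 -> B != 0 ->
  (forall e d, 0 < e -> 0 < d -> exists2 t, 0 < t < d &
    `|(xa + A * t `^ al) - (xb + B * t `^ be)| <= e * (t `^ al + t `^ be)) ->
  [/\ al = be, xa = xb & A = B].
Proof.
move=> al0 be0 A0 B0 H.
have xab : xa = xb.
  apply/eqP; rewrite -subr_eq0 -normr_eq0; apply/negPn/negP => D0.
  (* With e = 1 the gap is at most (|A| + 1) t^al + (|B| + 1) t^be; once each term is below a
     quarter of it, it is less than half of itself. *)
  have D'0 : 0 < `|xa - xb| / 4 by rewrite divr_gt0// lt_neqAle eq_sym D0/=.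
  have cA : 0 < `|A| + 1 by rewrite ltr_wpDl.
  have cB : 0 < `|B| + 1 by rewrite ltr_wpDl.
  have [d1 d10 H1] := powR_small al0 (divr_gt0 D'0 cA).
  have [d2 d20 H2] := powR_small be0 (divr_gt0 D'0 cB).
  have d0 : 0 < Num.min d1 d2 by rewrite lt_min d10.
  have [t /andP[t0]] := H 1 _ ltr01 d0; rewrite lt_min => /andP[td1 td2] Ht.
  have := H1 t; rewrite t0 td1 ltr_pdivlMr// => /(_ isT) K1.
  have := H2 t; rewrite t0 td2 ltr_pdivlMr// => /(_ isT) K2.
  have ta := powR_ge0 t al; have tb := powR_ge0 t be.
  have NA : `|A * t `^ al| = `|A| * t `^ al by rewrite normrM (ger0_norm ta).
  have NB : `|B * t `^ be| = `|B| * t `^ be by rewrite normrM (ger0_norm tb).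
  have : `|xa - xb| <= `|(xa + A * t `^ al) - (xb + B * t `^ be)| +
      (`|A * t `^ al| + `|B * t `^ be|).
    have -> : xa - xb = (xa + A * t `^ al - (xb + B * t `^ be)) +
      (B * t `^ be - A * t `^ al) by ring.
    apply: le_trans (ler_normD _ _) _; rewrite lerD2l.
    by apply: le_trans (ler_normB _ _) _; rewrite addrC.
  rewrite NA NB; lra.
move: H; rewrite xab => H.
have {}H e d : 0 < e -> 0 < d -> exists2 t, 0 < t < d &
    `|A * t `^ al - B * t `^ be| <= e * (t `^ al + t `^ be).
  move=> e0 d0; have [t td Ht] := H e d e0 d0; exists t => //.
  by move: Ht; rewrite opprD addrACA subrr add0r.
have albe : al = be.
  apply: contrapT => /eqP; rewrite neq_lt => /orP[lt|lt].
    exact: (powR_asymptotics_aux al0 lt A0 H).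
  apply: (powR_asymptotics_aux (B := A) be0 lt B0) => e d e0 d0.
  have [t td Ht] := H e d e0 d0; exists t => //.
  by rewrite distrC [_ `^ be + _]addrC.
split=> //; apply/eqP; rewrite -subr_eq0 -normr_le0; apply/ler_addgt0Pr => e e0.
rewrite add0r; have e20 : 0 < e / 2 by rewrite divr_gt0.
have [t /andP[t0 _]] := H _ _ e20 ltr01; rewrite albe -mulrBl normrM.
have tb : 0 < t `^ be by rewrite powR_gt0.
have -> : e / 2 * (t `^ be + t `^ be) = e * t `^ be by field.
by rewrite (gtr0_norm tb) ler_pM2r.
Qed.

Lemma lebesgue_aeI (P Q : R -> Prop) : {ae leb, forall t, P t} ->
  {ae leb, forall t, Q t} -> {ae leb, forall t, P t /\ Q t}.
Proof. exact: (@filterI _ _ (ae_filter_ringOfSetsType leb)). Qed.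

Lemma lebesgue_aeS (P Q : R -> Prop) : (forall t, P t -> Q t) ->
  {ae leb, forall t, P t} -> {ae leb, forall t, Q t}.
Proof. exact: (@filterS _ _ (ae_filter_ringOfSetsType leb)). Qed.

End real_asymptotics.

(** * Expansion of the observation of a solution at the initial time *)

Section solution.
Context {R : realType} {n : nat}.
Local Notation V := 'rV[R]_n.+1.
Local Notation leb := (@lebesgue_measure R).
Variable Omega : set V.
Hypothesis oO : open Omega.
Hypothesis bO : bounded_set Omega.
Let mO : measurable (Omega : set (Rn R n)) := measurable_open oO.
Local Notation L2 := (L2 Omega).
Local Notation L2dot := (L2dot Omega).
Local Notation L2norm := (L2norm Omega).

Lemma initial_value_near (T : R) (mu : R -> R) (mu0 : R) : initial_value T mu mu0 ->
  exists2 m : R -> R, {ae leb, forall t, 0 < t < T -> m t = mu t} &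
    forall e, 0 < e -> exists2 d, 0 < d & forall t, 0 < t < d -> `|m t - mu0| <= e.
Proof.
move=> [m mmu /eqO_exP[k k0 [d /= d0 Hd]]]; exists m => // e e0.
have dk0 : 0 < Num.min d (e / k) by rewrite lt_min d0 divr_gt0.
exists (Num.min d (e / k)) => // t; rewrite lt_min => /and3P[t0 td tk].
have := Hd t; rewrite /= sub0r normrN (gtr0_norm t0) => /(_ td t0) H.
by apply: le_trans H _; rewrite mulrC -ler_pdivlMr// ltW.
Qed.

Lemma continuous_rep_near0 (T : R) (u0 : V -> R) (u : R -> V -> R) (e : R) :
  continuous_rep Omega T u0 u -> 0 < T -> 0 < e ->
  exists2 d : R, 0 < d & forall t, 0 < t < d -> t <= T ->
    L2norm (fun x => u t x - u 0 x) <= e.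
Proof.
move=> [_ /(_ 0) + _] T0 e0; rewrite lexx ltW// => /(_ isT).
move=> /cvgrPdist_lt/(_ _ e0)[d /= d0 Hd].
exists d => // t /andP[t0 td] tT; apply: ltW.
have := Hd t; rewrite /= !sub0r !normrN (gtr0_norm t0) ger0_norm ?L2norm_ge0//.
by apply => //; rewrite in_itv/= tT ltW.
Qed.

Variables (a : 'I_n.+1 -> 'I_n.+1 -> V -> R) (c : V -> R).
Hypothesis ac_elliptic : elliptic_coeffs Omega a c.
Variables (T alpha mu0 : R) (u0 f psi : V -> R) (mu : R -> R) (u : R -> V -> R).
Hypothesis alpha01 : 0 < alpha < 1.
Hypothesis Lu0 : L2 u0.
Hypothesis Lf : L2 f.
Hypothesis T0 : 0 < T.
Hypothesis mu_init : initial_value T mu mu0.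
Hypothesis psi_dom : dom_op Omega psi.
Hypothesis u_sol : is_solution Omega a c T alpha u0 mu f u.
Hypothesis u_cont : continuous_rep Omega T u0 u.

Let Apsi := elliptic_op Omega a c psi.
Let cA := mu0 * L2dot f psi - L2dot u0 Apsi.

Let Lpsi : L2 psi.
Proof. by have [[[]]] := psi_dom. Qed.

Let LApsi : L2 Apsi.
Proof. by have [H2psi _] := psi_dom; exact: elliptic_op_L2. Qed.

(* (w, psi) = mu (f, psi) - (u, A psi) by self-adjointness of A. *)
Lemma source_pairing_near (w : R -> V -> R) (e : R) : 0 < e ->
  {ae leb, forall t, `]0, T[%classic t -> L2 (w t)} ->
  {ae leb, forall t, 0 < t < T ->
      ae_eq (@lebesgueN R n) Omega (fun x => w t x + elliptic_op Omega a c (u t) x)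
        (fun x => mu t * f x)} ->
  exists2 d, 0 < d <= T & {ae leb, forall t, 0 < t < d ->
    L2 (w t) /\ `|L2dot (w t) psi - cA| <= e}.
Proof.
move=> e0 wL2 weq.
have [[[udom _] _] _] := u_sol.
have [m mmu m_near] := initial_value_near mu_init.
pose F := `|L2dot f psi| + 1; have F0 : 0 < F by rewrite ltr_wpDl.
pose N := L2norm Apsi + 1; have N0 : 0 < N by rewrite ltr_wpDl// L2norm_ge0.
have eF : 0 < e / 2 / F by rewrite !divr_gt0.
have eN : 0 < e / 2 / N by rewrite !divr_gt0.
have [d1 d10 H1] := m_near _ eF.
have [d2 d20 H2] := continuous_rep_near0 u_cont T0 eN.
exists (Num.min T (Num.min d1 d2)).
  by rewrite !lt_min T0 d10 d20 ge_min lexx.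
apply: lebesgue_aeS (lebesgue_aeI (lebesgue_aeI wL2 udom) (lebesgue_aeI weq mmu)).
move=> t [[wt ut] [wet mt]] /andP[t0]; rewrite !lt_min => /and3P[tT td1 td2].
have t0T : 0 < t < T by rewrite t0.
have tI : `]0, T[%classic t by rewrite /= in_itv.
have Lw := wt tI; have domu := ut tI; have Lu : L2 (u t) by have [[[]]] := domu.
have LAu : L2 (elliptic_op Omega a c (u t)).
  by have [H2u _] := domu; exact: elliptic_op_L2.
split=> //.
have Lmf := L2Z mO (mu t) Lf.
have wpair : L2dot (w t) psi = mu t * L2dot f psi - L2dot (u t) Apsi.
  have := L2dot_ae mO (wet t0T) (L2D mO Lw LAu) Lpsi.
  rewrite (L2dotDl mO Lw LAu Lpsi) (L2dotZl mO _ Lf Lpsi).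
  by rewrite (elliptic_op_selfadjoint oO bO ac_elliptic domu psi_dom) -/Apsi => <-; rewrite addrK.
have [uL2 _ u00] := u_cont.
have Lu00 : L2 (u 0) by apply: uL2; rewrite lexx ltW.
(* [F] and [N] bound the two fixed factors, so each of the two terms is at most e / 2. The exact
   value [u 0] stands for [u0], to which it is equal almost everywhere. *)
have -> : L2dot (w t) psi - cA = (m t - mu0) * L2dot f psi -
    L2dot (fun x => u t x - u 0 x) Apsi.
  rewrite wpair /cA (L2dotBl mO Lu Lu00 LApsi) (L2dot_ae mO u00 Lu00 LApsi) mt//.
  by move: (L2dot f psi) (L2dot (u t) Apsi) (L2dot u0 Apsi) => p q r; ring.
apply: le_trans (ler_normB _ _) _; rewrite [leRHS](splitr e); apply: lerD.
  rewrite normrM; apply: (@le_trans _ _ (e / 2 / F * F)); last first.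
    by rewrite divfK ?gt_eqF.
  by apply: ler_pM; rewrite ?H1 ?t0 ?lerDl.
apply: le_trans (L2_CS mO (L2B mO Lu Lu00) LApsi) _.
apply: (@le_trans _ _ (e / 2 / N * N)); last by rewrite divfK ?gt_eqF.
apply: ler_pM; rewrite ?L2norm_ge0 ?lerDl//.
by apply: H2; rewrite ?t0// ltW.
Qed.

(** (u(t) - u0, psi) is 1 / Gamma(alpha) times the pairing of psi with the Bochner integral of the
    kernel times w, and near 0 the pairing (w, psi) is close to [cA]. The kernel has integral
    t^alpha / alpha. *)
Lemma solution_asymptotics (e : R) : 0 < e ->
  exists2 d, 0 < d <= T & {ae leb, forall t, 0 < t < d ->
    `|L2dot (u t) psi -
      (L2dot u0 psi + cA / (alpha * Gamma_fun alpha) * t `^ alpha)| <= e * t `^ alpha}.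
Proof.
move=> e0; have /andP[al0 al1] := alpha01.
have G0 : 0 < Gamma_fun alpha by apply: Gamma_fun_gt0; rewrite al0 ltW.
have aG0 : 0 < alpha * Gamma_fun alpha by rewrite mulr_gt0.
have [_ [w [[[wL2 _] _] wJ] weq]] := u_sol.
(* This tolerance for (w, psi), times t^alpha / alpha and divided by Gamma(alpha), becomes e
   t^alpha. *)
have eaG : 0 < e * (alpha * Gamma_fun alpha) by rewrite mulr_gt0.
have [d /andP[d0 dT] Hd] := source_pairing_near eaG wL2 weq.
exists d; first by rewrite d0.
apply: lebesgue_aeS wJ => t wJt /andP[t0 td].
have t0T : 0 < t < T by rewrite t0 (lt_le_trans td).
have [v vint uv] := wJt t0T.
have [uL2 _ _] := u_cont.
have Lut : L2 (u t) by apply: uL2; have /andP[/ltW -> /ltW ->] := t0T.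
have Lv : L2 v by have [] := vint.
have uvE : L2dot (u t) psi - L2dot u0 psi = (Gamma_fun alpha)^-1 * L2dot v psi.
  rewrite -(L2dotBl mO Lut Lu0 Lpsi) (L2dot_ae mO uv (L2B mO Lut Lu0) Lpsi).
  exact: (L2dotZl mO _ Lv Lpsi).
have mk : measurable_fun `]0, t[%classic (fun s : R => (t - s) `^ (alpha - 1)).
  apply: measurable_funTS; apply: (measurableT_comp (measurable_powR _)).
  by apply: measurable_funB => //; exact: measurable_cst.
have wt : {ae leb, forall s, `]0, t[%classic s ->
    L2 (w s) /\ `|L2dot (w s) psi - cA| <= e * (alpha * Gamma_fun alpha)}.
  apply: lebesgue_aeS Hd => s Hs; rewrite /= in_itv/= => /andP[s0 st]; apply: Hs.
  by rewrite s0 (lt_trans st).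
have := bochner_pairing_bound oO Lpsi (measurable_itv _) (fun s _ => powR_ge0 _ _) mk
  (integral_frac_kernel al0 t0) (ltW eaG) vint wt.
move=> H; have -> : L2dot (u t) psi - (L2dot u0 psi +
    cA / (alpha * Gamma_fun alpha) * t `^ alpha) =
    (Gamma_fun alpha)^-1 * (L2dot v psi - cA * (alpha^-1 * t `^ alpha)).
  rewrite opprD addrA uvE mulrBr; congr (_ - _).
  by move: cA (t `^ alpha) (Gamma_fun alpha) G0 => p q r r0; field; rewrite !gt_eqF.
rewrite normrM gtr0_norm ?invr_gt0//.
rewrite mulrC ler_pdivrMr//; apply: le_trans H _.
rewrite le_eqVlt; apply/orP; left; apply/eqP.
by move: (t `^ alpha) (Gamma_fun alpha) => q r; field; rewrite gt_eqF.
Qed.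

End solution.

Theorem theorem2p8 (R : realType) (n : nat) (Omega : set 'rV[R]_n.+1)
  (coefA : 'I_n.+1 -> 'I_n.+1 -> 'rV[R]_n.+1 -> R) (c : 'rV[R]_n.+1 -> R)
  (coefB : 'I_n.+1 -> 'I_n.+1 -> 'rV[R]_n.+1 -> R) (d : 'rV[R]_n.+1 -> R)
  (T alpha beta : R) (a b f g psi : 'rV[R]_n.+1 -> R)
  (mu nu : R -> R) (mu0 nu0 : R) (u v : R -> 'rV[R]_n.+1 -> R)
  (hOmega : smooth_domain Omega)
  (hA : elliptic_coeffs Omega coefA c)
  (hB : elliptic_coeffs Omega coefB d)
  (halpha : 0 < alpha < 1) (hbeta : 0 < beta < 1)
  (ha : H10 Omega a) (hb : H10 Omega b)
  (hf : L2 Omega f) (hg : L2 Omega g)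
  (hT : 0 < T)
  (hmu : Linfty T mu) (hnu : Linfty T nu)
  (hmu0 : initial_value T mu mu0) (hnu0 : initial_value T nu nu0)
  (hpsiA : dom_op2 Omega coefA c psi) (hpsiB : dom_op2 Omega coefB d psi)
  (hcA : mu0 * L2dot Omega f psi
         - L2dot Omega a (elliptic_op Omega coefA c psi) <> 0)
  (hcB : nu0 * L2dot Omega g psi
         - L2dot Omega b (elliptic_op Omega coefB d psi) <> 0)
  (hu : is_solution Omega coefA c T alpha a mu f u)
  (hu_cont : continuous_rep Omega T a u)
  (hv : is_solution Omega coefB d T beta b nu g v)
  (hv_cont : continuous_rep Omega T b v)
  (hobs : forall t, 0 < t < T -> L2dot Omega (u t) psi = L2dot Omega (v t) psi) :
  [/\ alpha = beta,
      L2dot Omega a psi = L2dot Omega b psi &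
      mu0 * L2dot Omega f psi
        - L2dot Omega a (elliptic_op Omega coefA c psi)
      = nu0 * L2dot Omega g psi
        - L2dot Omega b (elliptic_op Omega coefB d psi)].
Proof.
have [_ oO _ bO _] := hOmega.
have La : L2 Omega a by have [[]] := ha.
have Lb : L2 Omega b by have [[]] := hb.
have [psiA _] := hpsiA; have [psiB _] := hpsiB.
have HA := solution_asymptotics oO bO hA halpha La hf hT hmu0 psiA hu hu_cont.
have HB := solution_asymptotics oO bO hB hbeta Lb hg hT hnu0 psiB hv hv_cont.
move: HA HB hcA hcB; set cA := mu0 * _ - _; set cB := nu0 * _ - _.
move=> HA HB /eqP cA0 /eqP cB0.
have /andP[al0 al1] := halpha; have /andP[be0 be1] := hbeta.
have aG0 : 0 < alpha * Gamma_fun alpha.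
  by rewrite mulr_gt0//; apply: Gamma_fun_gt0; rewrite al0 ltW.
have bG0 : 0 < beta * Gamma_fun beta.
  by rewrite mulr_gt0//; apply: Gamma_fun_gt0; rewrite be0 ltW.
have A0 : cA / (alpha * Gamma_fun alpha) != 0.
  by apply: mulf_neq0; [exact: cA0|rewrite invr_neq0// gt_eqF].
have B0 : cB / (beta * Gamma_fun beta) != 0.
  by apply: mulf_neq0; [exact: cB0|rewrite invr_neq0// gt_eqF].
have [|alE abE AB] := powR_asymptotics_match (xa := L2dot Omega a psi)
    (xb := L2dot Omega b psi) al0 be0 A0 B0; last first.
- split; [exact: alE|exact: abE|].
  (* Equal orders make the two denominators equal, so the equality of leading coefficients is that
     of [cA] and [cB]. *)
  by move: AB; rewrite -alE => /divIf; apply; rewrite gt_eqF.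
move=> e d' e0 d'0.
have [dA /andP[dA0 dAT] aeA] := HA _ e0; have [dB /andP[dB0 dBT] aeB] := HB _ e0.
have dm0 : 0 < Num.min d' (Num.min dA dB) by rewrite !lt_min d'0 dA0.
(* At such a t the observation identifies the two pairings, and the triangle inequality through
   their common value compares the expansions. *)
have [t /andP[t0]] := lebesgue_ae_exists dm0 (lebesgue_aeI aeA aeB).
rewrite !lt_min => /and3P[td' tdA tdB] [HtA HtB].
exists t; first by rewrite t0.
move: HtA HtB; rewrite t0 tdA tdB => /(_ isT) HtA /(_ isT).
rewrite -(hobs t); last by rewrite t0 (lt_le_trans tdA).
move=> HtB; rewrite -(subrKA (L2dot Omega (u t) psi)).
apply: le_trans (ler_normD _ _) _; rewrite mulrDr; apply: lerD => //.
by rewrite distrC.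
Qed.
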